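(* Let $X$ be a $(p\,;q)$ cookie random walk (i.e. $M=1$, with $p\in[0,1)$ and $q\in(0,1)$) and define $$\lambda_1=(1-p)\left(\frac{q}{b(1-q)}\right)^2+\frac{(b-1)p}{b}\left(\frac{q}{b(1-q)}\right)+\frac pb.$$ Then $X$ is recurrent if and only if $\lambda_1\le 1/b$.
   Context: Fix an integer $b\ge2$. $\mathbb{T}$ is the infinite rooted $b$-ary tree with root $o$; each vertex $x$ has $b$ sons, each $x\ne o$ has a father, and by convention the father of $o$ is $o$ itself. A cookie environment is a vector $\mathcal{C}=(p_1,\ldots,p_M\,;q)\in[0,1)^M\times(0,1)$ with $M\ge1$. A $\mathcal{C}$ cookie random walk is a process $X=(X_n)_{n\ge0}$ on $\mathbb{T}$ with $X_0=o$ such that, conditionally on $X_0,\ldots,X_n$, with $j=\#\{0\le k\le n: X_k=X_n\}$, $X_{n+1}$ is each given son of $X_n$ with probability $p_j/b$ if $j\le M$ and $q/b$ if $j>M$, and is the father of $X_n$ with probability $1-p_j$ if $j\le M$ and $1-q$ if $j>M$. The walk is recurrent if it visits every vertex of $\mathbb{T}$ infinitely often with probability $1$. *)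

(* Defs.v *)
From HB Require Import structures.
From mathcomp Require Import all_boot all_order all_algebra.
From mathcomp Require Import all_classical all_reals all_analysis.
Set Implicit Arguments.
Unset Strict Implicit.
Unset Printing Implicit Defensive.
Import Order.TTheory GRing.Theory Num.Theory.
Local Open Scope classical_set_scope.
Local Open Scope ring_scope.

(* Vertices of the infinite rooted b-ary tree: the address of a vertex is the
   list of choices leading to it from the root, most recent choice first. *)
Definition vertex (b : nat) := seq 'I_b.
Definition root_vertex (b : nat) : vertex b := [::].
Definition son (b : nat) (x : vertex b) (i : 'I_b) : vertex b := i :: x.
(* [behead [::] = [::]]: the father of the root is the root itself. *)
Definition father (b : nat) (x : vertex b) : vertex b := behead x.

(* The number of k <= n such that x k = x n; it is always at least 1. *)
Definition visits (b : nat) (x : nat -> vertex b) (n : nat) : nat :=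
  #|[set k : 'I_n.+1 | x k == x n]%SET|.

(* In the environment (p_1, ..., p_M ; q), the value p_j if j <= M, and q if
   j > M. Here j >= 1, and the sequence ps is indexed from 0. *)
Definition cookie_strength (R : realType) (ps : seq R) (q : R) (j : nat) : R :=
  nth q ps j.-1.

(* Elementary conditional probability P(A | B), meaningful when P B != 0. *)
Definition cond_prob d (Omega : measurableType d) (R : realType)
    (P : probability Omega R) (A B : set Omega) : R :=
  fine (P (A `&` B)) / fine (P B).

Definition history d (Omega : measurableType d) (b : nat)
    (X : nat -> Omega -> vertex b) (n : nat) (x : nat -> vertex b) : set Omega :=
  [set w | forall k, (k <= n)%N -> X k w = x k].

Record cookie_random_walk d (Omega : measurableType d) (R : realType)
    (P : probability Omega R) (b : nat) (ps : seq R) (q : R)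
    (X : nat -> Omega -> vertex b) : Prop := CookieRandomWalk {
  (* the set of vertices is countable and carries the discrete sigma-algebra *)
  walk_measurable : forall n v, measurable (X n @^-1` [set v]) ;
  walk_start : P (X 0 @^-1` [set root_vertex b]) = 1%E ;
  walk_son : forall (n : nat) (x : nat -> vertex b) (i : 'I_b),
    P (history X n x) != 0%E ->
    cond_prob P (X n.+1 @^-1` [set son (x n) i]) (history X n x)
      = cookie_strength ps q (visits x n) / b%:R ;
  walk_father : forall (n : nat) (x : nat -> vertex b),
    P (history X n x) != 0%E ->
    cond_prob P (X n.+1 @^-1` [set father (x n)]) (history X n x)
      = 1 - cookie_strength ps q (visits x n) }.

Definition recurrent d (Omega : measurableType d) (R : realType)
    (P : probability Omega R) (b : nat) (X : nat -> Omega -> vertex b) : Prop :=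
  P [set w | forall (v : vertex b) (N : nat),
               exists2 n, (N <= n)%N & X n w = v] = 1%E.

Definition lambda1 (R : realType) (b : nat) (p q : R) : R :=
  (1 - p) * (q / (b%:R * (1 - q))) ^+ 2
  + (b%:R - 1) * p / b%:R * (q / (b%:R * (1 - q)))
  + p / b%:R.

(* Main.v *)
Require Import Defs.
From HB Require Import structures.
From mathcomp Require Import all_boot all_order all_algebra.
From mathcomp Require Import all_classical all_reals all_analysis.
From mathcomp Require Import ring lra zify.
Import Order.TTheory GRing.Theory Num.Theory.
Import numFieldNormedType.Exports.
Local Open Scope ring_scope.
Set Implicit Arguments.
Unset Strict Implicit.
Unset Printing Implicit Defensive.

(** Why the theorem holds. Let [m = q / (b (1 - q))] be the mean number of steps to
    a given son per step to the father ([son_mean]). If a vertex is entered [j]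
    times and left again [j] times, the numbers of steps to its sons have an
    explicit law, and given these numbers the subtrees of the sons are explored
    independently. The explored tree is therefore a branching process whose types
    are the numbers of visits, and the walk is recurrent if and only if this
    process dies out from every type.

    The mean matrix of the process is [b] times the kernel that gives the number
    of entries into one fixed son. With a single cookie and [m < 1], this kernel
    has an explicit positive left eigenvector, the geometric measure of ratio [m],
    and its eigenvalue is [lambda1] ([geosum_one_son], [image_mass_mean]): apart
    from the cookie, a step of the kernel composes generating functions with a
    Moebius map fixing [1] and [m^-1], and the cookie only contributes an affine
    factor.

    Pair the probabilities of survival down to depth [d] with this eigenvector. If
    [b * lambda1 <= 1], the result cannot increase with [d], and it loses at each
    step the probability that two sons survive together, so the survival
    probabilities tend to [0], even in the critical case ([survive_subcritical]).
    If [b * lambda1 > 1] and they tended to [0], then survival would come mostly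
    from vertices that are entered a bounded number of times ([mass_tight]), pairs
    of surviving sons would be negligible, and the pairing would grow
    ([survive_supercritical]). For [m >= 1] one has [lambda1 >= 1], and the walk is
    compared with one that has a smaller [q] ([survive_transient]).

    The branching process itself is never constructed. Instead [win] is the
    probability, written as an explicit function of the past, that the root is
    left [k] more times before level [L] is reached. It is harmonic along the walk
    ([win_harmonic]), which bounds the corresponding probabilities at any finite
    time from both sides ([win_le_expect], [expect_le_win]). They pass to the limit
    because a step that is possible infinitely often is almost surely taken
    infinitely often ([ae_step]). *)

(** * Geometric series with bounded coefficients *)

Section GeometricSums.
Local Open Scope classical_set_scope.
Local Open Scope ring_scope.
Variable R : realType.
Implicit Types (t u v M : R) (a c : nat -> R).

Definition is_bounded (T : Type) (F : T -> R) :=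
  exists M : R, forall x, `|F x| <= M.

Lemma bounded_ge0 T (F : T -> R) :
  is_bounded F -> exists2 M, 0 <= M & forall x, `|F x| <= M.
Proof.
case=> M FM; exists `|M| => // x.
exact: le_trans (FM x) (ler_norm _).
Qed.

Lemma bounded_lin T (F G : T -> R) u v :
  is_bounded F -> is_bounded G ->
  is_bounded (fun x => u * F x + v * G x).
Proof.
move=> [M FM] [N GN]; exists (`|u| * M + `|v| * N) => x.
apply: le_trans (ler_normD _ _) _; rewrite !normrM.
by apply: lerD; apply: ler_wpM2l.
Qed.

Lemma bounded_01 T (F : T -> R) : (forall x, 0 <= F x <= 1) -> is_bounded F.
Proof.
by move=> F01; exists 1 => x; have /andP[? ?] := F01 x; rewrite ger0_norm.
Qed.

Lemma bounded_cst T u : is_bounded (fun _ : T => u).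
Proof. by exists `|u|. Qed.

Lemma bounded_comp S T (h : S -> T) (F : T -> R) :
  is_bounded F -> is_bounded (fun x => F (h x)).
Proof. by case=> M FM; exists M. Qed.

Definition geosum t a : R := limn (series (fun k => t ^+ k * a k)).

Section Ratio.
Variables (t : R) (t0 : 0 <= t) (t1 : t < 1).

Lemma geosum_cvg a : is_bounded a -> cvgn (series (fun k => t ^+ k * a k)).
Proof.
move=> [M aM]; apply: normed_cvg.
apply: (@series_le_cvg R _ (geometric M t)) => [k|k|k|].
- exact: normr_ge0.
- rewrite /geometric /= mulr_ge0 ?exprn_ge0 //.
  exact: le_trans (aM 0%N).
- by rewrite /geometric /= normrM normrX (ger0_norm t0) mulrC ler_wpM2r ?exprn_ge0.
- by apply: is_cvg_geometric_series; rewrite ger0_norm.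
Qed.

Lemma geosum_lin u v a c : is_bounded a -> is_bounded c ->
  geosum t (fun k => u * a k + v * c k) = u * geosum t a + v * geosum t c.
Proof.
move=> ba bc; rewrite /geosum.
have ca := geosum_cvg ba; have cc := geosum_cvg bc.
apply/cvg_lim => //.
have -> : series (fun k => t ^+ k * (u * a k + v * c k)) =
   (fun n => u * series (fun k => t ^+ k * a k) n
           + v * series (fun k => t ^+ k * c k) n).
  apply/funext => n; rewrite /series /= !big_distrr /= -big_split /=.
  by apply: eq_bigr => i _; ring.
by apply: cvgD; apply: cvgMr.
Qed.

Lemma ler_geosum a c : is_bounded a -> is_bounded c ->
  (forall k, a k <= c k) -> geosum t a <= geosum t c.
Proof.
move=> ba bc ac; apply: ler_lim; [exact: geosum_cvg..|].
apply: nearW => n; apply: ler_sum => k _.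
by rewrite ler_wpM2l ?exprn_ge0.
Qed.

Lemma geosumS a : is_bounded a ->
  geosum t a = a 0%N + t * geosum t (fun k => a k.+1).
Proof.
move=> ba.
have baS : is_bounded (fun k => a k.+1) by case: ba => M aM; exists M.
have cS := geosum_cvg baS.
rewrite /geosum; apply/cvg_lim => //; rewrite -cvg_shiftS /=.
have -> : (fun n => series (fun k => t ^+ k * a k) n.+1) =
   (fun n => a 0%N + t * series (fun k => t ^+ k * a k.+1) n).
  apply/funext => n; rewrite /series /= big_nat_recl // expr0 mul1r.
  congr (_ + _); rewrite big_distrr /=.
  by apply: eq_bigr => i _; rewrite exprS; ring.
by apply: cvgD; [exact: cvg_cst|apply: cvgMr].
Qed.

Lemma geosum_cst u : geosum t (fun=> u) = u / (1 - t).
Proof.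
have := @geosumS (fun=> u) (bounded_cst _ _).
have ? : 1 - t != 0 by rewrite subr_eq0 eq_sym lt_eqF.
move=> e; apply: (canRL (mulfK _)) => //.
by rewrite mulrBr mulr1 {1}e; ring.
Qed.

Lemma geosum_sum (I : Type) (r : seq I) (u : R) (f : I -> nat -> R) :
  (forall i, is_bounded (f i)) ->
  geosum t (fun k => u * \sum_(i <- r) f i k) = u * \sum_(i <- r) geosum t (f i).
Proof.
move=> bf; elim: r => [|i r IH].
  under eq_fun do rewrite big_nil mulr0.
  by rewrite geosum_cst mul0r big_nil mulr0.
under eq_fun do rewrite big_cons mulrDr -[u * bigop _ _ _]mul1r.
rewrite geosum_lin ?mul1r ?IH ?big_cons ?mulrDr //.
elim: r {IH} => [|j r IH].
  by under eq_fun do rewrite big_nil mulr0; exact: bounded_cst.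
under eq_fun do rewrite big_cons mulrDr -[u * bigop _ _ _]mul1r.
exact: bounded_lin.
Qed.

Lemma geosum_ge0 a : is_bounded a -> (forall k, 0 <= a k) -> 0 <= geosum t a.
Proof.
move=> ba a0; have := @ler_geosum (fun=> 0) a _ ba a0.
rewrite geosum_cst mul0r; apply => //; exact: bounded_cst.
Qed.

Lemma geosum_ge a n : is_bounded a -> (forall k, 0 <= a k) ->
  t ^+ n * a n <= geosum t a.
Proof.
elim: n a => [|n IH] a ba a0.
  rewrite expr0 mul1r geosumS // lerDl mulr_ge0 // geosum_ge0 //.
  by case: ba => M aM; exists M.
have baS : is_bounded (fun k => a k.+1) by case: ba => M aM; exists M.
rewrite geosumS // exprS -mulrA ler_wpDl // ler_wpM2l //.
exact: (IH (fun k => a k.+1)).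
Qed.

Lemma geosum_norm a M : (forall k, `|a k| <= M) -> `|geosum t a| <= M / (1 - t).
Proof.
move=> aM; have ba : is_bounded a by exists M.
have bM := @bounded_cst nat.
have := geosum_cst M; have := geosum_cst (- M) => eN eP.
rewrite ler_norml -mulNr -eP -eN.
by apply/andP; split; apply: ler_geosum => // k; have := aM k;
   rewrite ler_norml => /andP[].
Qed.

Lemma geometric_small M e : 0 < e -> exists n, t ^+ n * M <= e.
Proof.
move=> e0.
have /cvgrPdist_lt /(_ e e0) [n _ /(_ n (leqnn n))] : (fun n => t ^+ n * M) @ \oo --> 0.
  rewrite -[X in _ --> X](mul0r M); apply: cvgMl.
  by apply: cvg_expr; rewrite ger0_norm.
rewrite sub0r normrN => H; exists n; apply: ltW.
exact: le_lt_trans (ler_norm _) H.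
Qed.

(** The recursion has only one bounded solution: the value at [0] of the
    difference of two of them is [t ^+ n] times its value at [n]. *)
Lemma geosum_uniq a x : is_bounded a -> is_bounded x ->
  (forall n, x n = a n + t * x n.+1) -> x 0%N = geosum t a.
Proof.
move=> ba bx xr.
pose D n := x n - geosum t (fun k => a (n + k)%N).
have bshift n : is_bounded (fun k => a (n + k)%N).
  by case: ba => M aM; exists M.
have DS n : D n = t * D n.+1.
  rewrite /D {1}xr {1}geosumS // addn0.
  rewrite (_ : (fun k => a (n + k.+1)%N) = (fun k => a (n.+1 + k)%N)); first by ring.
  by apply/funext => k; rewrite addnS addSn.
have D0 n : D 0%N = t ^+ n * D n.
  by elim: n => [|n IH]; rewrite ?expr0 ?mul1r // IH {1}DS exprSr mulrA.
have [M DM] : is_bounded D.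
  case: bx => M xM; have [N aN] := ba; exists (M + N / (1 - t)) => n.
  by apply: le_trans (ler_normB _ _) _; apply: lerD => //; apply: geosum_norm.
suff /eqP : D 0%N == 0 by move/subr0_eq => ->.
rewrite -normr_le0; apply/ler_addgt0Pr => e e0; rewrite add0r.
have [n] := geometric_small M e0.
apply: le_trans; rewrite (D0 n) normrM normrX (ger0_norm t0).
by rewrite ler_wpM2l ?exprn_ge0.
Qed.

End Ratio.

Lemma ler_geosum3 t1 t2 t3 u v a c e :
  0 <= t1 < 1 -> 0 <= t2 < 1 -> 0 <= t3 < 1 ->
  is_bounded a -> is_bounded c -> is_bounded e ->
  (forall k, t1 ^+ k * a k <= u * (t2 ^+ k * c k) + v * (t3 ^+ k * e k)) ->
  geosum t1 a <= u * geosum t2 c + v * geosum t3 e.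
Proof.
move=> /andP[? ?] /andP[? ?] /andP[? ?] ba bc be H.
have [ca [cc ce]] : cvgn (series (fun k => t1 ^+ k * a k)) /\
    cvgn (series (fun k => t2 ^+ k * c k)) /\ cvgn (series (fun k => t3 ^+ k * e k)).
  by split; [|split]; exact: geosum_cvg.
have clin : (fun n => u * series (fun k => t2 ^+ k * c k) n
                    + v * series (fun k => t3 ^+ k * e k) n) @ \oo
            --> u * geosum t2 c + v * geosum t3 e.
  by apply: cvgD; apply: cvgMr.
rewrite -(cvg_lim _ clin) //; apply: ler_lim => //.
  by apply/cvg_ex; eexists; exact: clin.
apply: nearW => n; rewrite /series /= !big_distrr /= -big_split /=.
exact: ler_sum.
Qed.

End GeometricSums.

(** * Counting the jumps made between two returns to the father *)

Section JumpCounts.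
Local Open Scope ring_scope.
Variables (R : realType) (b : nat).
Hypothesis b_gt0 : (0 < b)%N.

Definition counts := {ffun 'I_b -> nat}.
Implicit Types (F G D : counts -> R) (z : counts) (q s u v M : R) (i : 'I_b).

Definition zero_counts : counts := [ffun=> 0%N].
Definition incr i z : counts := [ffun i' => (z i' + (i' == i))%N].

Lemma incrC i i' z : incr i (incr i' z) = incr i' (incr i z).
Proof. by apply/ffunP => k; rewrite !ffunE addnAC. Qed.

Definition avg F z : R := b%:R^-1 * \sum_(i < b) F (incr i z).

Lemma avg_lin u v F G :
  avg (fun z => u * F z + v * G z) = fun z => u * avg F z + v * avg G z.
Proof.
apply/funext => z; rewrite /avg big_split /= -!big_distrr /=; ring.
Qed.

Lemma avg_cst u z : avg (fun=> u) z = u.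
Proof.
rewrite /avg sumr_const card_ord -[X in _ * X]mulr_natl mulrA mulVf ?mul1r //.
by rewrite pnatr_eq0 -lt0n.
Qed.

Lemma ler_avg F G z : (forall z, F z <= G z) -> avg F z <= avg G z.
Proof.
by move=> FG; rewrite /avg ler_wpM2l ?invr_ge0 ?ler0n // ler_sum.
Qed.

Lemma avg_norm F M z : (forall z, `|F z| <= M) -> `|avg F z| <= M.
Proof.
move=> FM; rewrite ler_norml -{1}(avg_cst M z) -{2}(avg_cst M z).
have -> : - avg (fun=> M) z = avg (fun=> - M) z by rewrite !avg_cst.
by rewrite !ler_avg // => z'; have := FM z'; rewrite ler_norml => /andP[].
Qed.

Lemma iter_avg_norm F M n z : (forall z, `|F z| <= M) -> `|iter n avg F z| <= M.
Proof. by move=> FM; elim: n z => // n IH z; exact: avg_norm. Qed.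

(** Expected value of [F] at the counts reached when the walker, who moves to a
    uniform son with probability [q] and otherwise to the father, first moves to
    the father: [1 - q] times the resolvent of [avg]. *)
Definition until_father q F z : R := (1 - q) * geosum q (fun n => iter n avg F z).

Section Strength.
Variables (q : R) (q0 : 0 <= q) (q1 : q < 1).
Local Notation J := (until_father q).

Lemma until_father_step F : is_bounded F ->
  J F = fun z => (1 - q) * F z + q * avg (J F) z.
Proof.
move=> [M FM]; apply/funext => z; rewrite /until_father.
have bF z' : is_bounded (fun n => iter n avg F z').
  by exists M => n; exact: iter_avg_norm.
rewrite geosumS //= mulrDr; congr (_ + _).
have := geosum_sum q0 q1 (index_enum 'I_b) b%:R^-1 (fun i => bF (incr i z)).
move=> E; move: (geosum _ _) E => g ->.
have -> : avg (until_father q F) z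
          = (1 - q) * (b%:R^-1 * \sum_i geosum q (fun n => iter n avg F (incr i z))).
  by rewrite /avg /until_father -big_distrr /= mulrCA.
by rewrite mulrCA.
Qed.

Lemma until_father_norm F M : (forall z, `|F z| <= M) -> forall z, `|J F z| <= M.
Proof.
move=> FM z; rewrite /until_father normrM (@ger0_norm _ (1 - q)); last by rewrite subr_ge0 ltW.
rewrite mulrC.
have H : `|geosum q (fun n => iter n avg F z)| <= M / (1 - q).
  by apply: geosum_norm => // n; exact: iter_avg_norm.
by rewrite -ler_pdivlMr ?subr_gt0.
Qed.

Lemma until_father_bounded F : is_bounded F -> is_bounded (J F).
Proof. by case=> M FM; exists M; exact: until_father_norm. Qed.

(** Maximum principle: a positive supremum would be multiplied by at most
    [q < 1]. It makes bounded solutions of [until_father_step] comparable. *)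
Lemma max_principle D : is_bounded D ->
  (forall z, D z <= q * avg D z) -> forall z, D z <= 0.
Proof.
move=> [M DM] Dsub z; apply/ler_addgt0Pr => e e0; rewrite add0r.
have [n] := geometric_small q0 q1 M e0; apply: le_trans.
elim: n z => [|n IH] z.
  by rewrite expr0 mul1r; apply: le_trans (DM z); exact: ler_norm.
rewrite exprS -mulrA; apply: le_trans (Dsub z) _; rewrite ler_wpM2l //.
by rewrite -(avg_cst (q ^+ n * M) z); exact: ler_avg.
Qed.

Lemma ler_until_father F G : is_bounded F -> is_bounded G ->
  (forall z, F z <= G z) -> forall z, J F z <= J G z.
Proof.
move=> bF bG FG z; rewrite -subr_le0.
suff H : forall z, 1 * J F z + -1 * J G z <= 0 by have := H z; lra.
apply: max_principle; first by apply: bounded_lin; exact: until_father_bounded.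
move=> {}z; rewrite avg_lin {1}(until_father_step bF) {1}(until_father_step bG).
rewrite -subr_ge0 (_ : _ - _ = (1 - q) * (G z - F z)); last by ring.
by rewrite mulr_ge0 ?subr_ge0 // ltW.
Qed.

Lemma until_father_lin u v F G : is_bounded F -> is_bounded G ->
  J (fun z => u * F z + v * G z) = fun z => u * J F z + v * J G z.
Proof.
move=> bF bG; have bFG := bounded_lin u v bF bG; apply/funext => z.
have [bJF bJG] := (until_father_bounded bF, until_father_bounded bG).
pose D z := 1 * J (fun z => u * F z + v * G z) z
            + -1 * (u * J F z + v * J G z).
have bD : is_bounded D.
  by apply: bounded_lin; [exact: until_father_bounded|exact: bounded_lin].
have DS z' : D z' = q * avg D z'.
  rewrite /D !avg_lin {1}(until_father_step bFG).
  rewrite {1}(until_father_step bF) {1}(until_father_step bG); ring.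
have DP z' : D z' <= 0 by apply: max_principle => // z''; rewrite {1}DS.
have bN : is_bounded (fun z => -1 * D z + 0 * D z) by exact: bounded_lin.
have DN z' : -1 * D z' + 0 * D z' <= 0.
  move: z'; apply: max_principle => // z''; rewrite avg_lin {1}DS; lra.
have := DP z; have := DN z; rewrite /D; lra.
Qed.

Lemma until_father_incr i F z : J (F \o incr i) z = J F (incr i z).
Proof.
rewrite /until_father; congr (_ * geosum _ _); apply/funext => n.
elim: n z => //= n IH z; rewrite /avg; congr (_ * _); apply: eq_bigr => i' _.
by rewrite IH incrC.
Qed.

(** Expectation under the negative multinomial law: the counts are those
    reached at the [k]-th move to the father. *)
Definition jumps k F z : R := iter k J F z.

Lemma jumpsSE k F : jumps k.+1 F = J (jumps k F).
Proof. by []. Qed.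

Lemma jumps_norm k F M : (forall z, `|F z| <= M) -> forall z, `|jumps k F z| <= M.
Proof. by move=> FM; elim: k => //= k IH; exact: until_father_norm. Qed.

Lemma jumps_bounded k F : is_bounded F -> is_bounded (jumps k F).
Proof. by case=> M FM; exists M; exact: jumps_norm. Qed.

Lemma jumpsS k F z : is_bounded F ->
  jumps k.+1 F z = (1 - q) * jumps k F z + q * avg (jumps k.+1 F) z.
Proof.
by move=> bF; rewrite {1}/jumps /= until_father_step //; exact: jumps_bounded.
Qed.

Lemma ler_jumps k F G : is_bounded F -> is_bounded G ->
  (forall z, F z <= G z) -> forall z, jumps k F z <= jumps k G z.
Proof.
move=> bF bG FG; elim: k => //= k IH z.
by apply: ler_until_father => //; exact: jumps_bounded.
Qed.

Lemma jumps_lin u v k F G : is_bounded F -> is_bounded G ->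
  jumps k (fun z => u * F z + v * G z) = fun z => u * jumps k F z + v * jumps k G z.
Proof.
move=> bF bG; elim: k => //= k IH.
rewrite !jumpsSE IH.
by rewrite until_father_lin //; exact: jumps_bounded.
Qed.

Lemma jumps_sum (I : Type) (r : seq I) (w : I -> R) k (F : I -> counts -> R) :
  (forall o, is_bounded (F o)) ->
  jumps k (fun z => \sum_(o <- r) w o * F o z)
  = fun z => \sum_(o <- r) w o * jumps k (F o) z.
Proof.
move=> bF; elim: r => [|o r IH].
  rewrite (_ : (fun z => _) = fun z => 0 * 0 + 0 * (0 : R)).
    rewrite jumps_lin; try exact: bounded_cst.
    by apply/funext => z; rewrite big_nil !mul0r addr0.
  by apply/funext => z; rewrite big_nil !mul0r addr0.
rewrite (_ : (fun z => _) =
    fun z => w o * F o z + 1 * (\sum_(o <- r) w o * F o z)); last first.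
  by apply/funext => z; rewrite big_cons mul1r.
rewrite jumps_lin //; first by apply/funext => z; rewrite IH big_cons mul1r.
elim: r {IH} => [|o' r IH].
  by under eq_fun do rewrite big_nil; exact: bounded_cst.
under eq_fun do rewrite big_cons -[bigop _ _ _]mul1r.
exact: bounded_lin.
Qed.

Lemma until_father_cst u : J (fun=> u) = fun=> u.
Proof.
apply/funext => z; rewrite /until_father.
rewrite (_ : (fun n => _) = fun=> u); last first.
  by apply/funext => n; elim: n z => //= n IH z; rewrite -[RHS](avg_cst u z) /avg;
     congr (_ * _); apply: eq_bigr.
by rewrite geosum_cst // mulrC divfK // subr_eq0 eq_sym lt_eqF.
Qed.

Lemma jumps_cst k u z : jumps k (fun=> u) z = u.
Proof.
elim: k z => // k IH z; rewrite jumpsSE.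
by have -> : jumps k (fun=> u) = (fun=> u); [exact/funext|rewrite until_father_cst].
Qed.

Lemma jumps_incr i k F z : jumps k (F \o incr i) z = jumps k F (incr i z).
Proof.
elim: k z => // k IH z; rewrite !jumpsSE -until_father_incr.
by congr (J _ z); exact/funext.
Qed.

Lemma jumps_ge0 k F : is_bounded F -> (forall z, 0 <= F z) ->
  forall z, 0 <= jumps k F z.
Proof.
move=> bF F0 z; rewrite -(jumps_cst k 0 z).
by apply: ler_jumps => //; exact: bounded_cst.
Qed.

Lemma jumps_01 k F : (forall z, 0 <= F z <= 1) -> forall z, 0 <= jumps k F z <= 1.
Proof.
move=> F01 z; have bF := bounded_01 F01.
rewrite jumps_ge0 //= => [|z']; last by case/andP: (F01 z').
rewrite -(jumps_cst k 1 z); apply: ler_jumps => //; first exact: bounded_cst.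
by move=> z'; case/andP: (F01 z').
Qed.

(** The same when the first instruction has strength [s]: a move to the father
    leaves [j.-1] returns to wait for, a move to a son leaves [j]. *)
Definition first_visit s F j : R :=
  (1 - s) * jumps j.-1 F zero_counts + s * avg (jumps j F) zero_counts.

Lemma first_visit_same j F : is_bounded F ->
  first_visit q F j.+1 = jumps j.+1 F zero_counts.
Proof. by move=> bF; rewrite jumpsS. Qed.

Lemma first_visit_lin u v s j F G : is_bounded F -> is_bounded G ->
  first_visit s (fun z => u * F z + v * G z) j
  = u * first_visit s F j + v * first_visit s G j.
Proof.
by move=> bF bG; rewrite /first_visit !jumps_lin // avg_lin; ring.
Qed.

Lemma first_visit_cst u s j : first_visit s (fun=> u) j = u.
Proof.
rewrite /first_visit jumps_cst (_ : jumps j _ = fun=> u) ?avg_cst; first by ring.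
by apply/funext => z; rewrite jumps_cst.
Qed.

Lemma ler_first_visit s j F G : 0 <= s <= 1 -> is_bounded F -> is_bounded G ->
  (forall z, F z <= G z) -> first_visit s F j <= first_visit s G j.
Proof.
move=> /andP[s0 s1] bF bG FG; rewrite /first_visit lerD //.
  by rewrite ler_wpM2l ?subr_ge0 //; exact: ler_jumps.
by rewrite ler_wpM2l //; apply: ler_avg; exact: ler_jumps.
Qed.

Lemma first_visit_ge0 s j F : 0 <= s <= 1 -> is_bounded F ->
  (forall z, 0 <= F z) -> 0 <= first_visit s F j.
Proof.
move=> s01 bF F0; rewrite -(first_visit_cst 0 s j).
by apply: ler_first_visit => //; exact: bounded_cst.
Qed.

Lemma first_visit_01 s j F : 0 <= s <= 1 -> (forall z, 0 <= F z <= 1) ->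
  0 <= first_visit s F j <= 1.
Proof.
move=> s01 F01; have bF := bounded_01 F01.
rewrite first_visit_ge0 //= => [|z]; last by case/andP: (F01 z).
rewrite -[X in _ <= X](first_visit_cst 1 s j).
apply: ler_first_visit => //; first exact: bounded_cst.
by move=> z; case/andP: (F01 z).
Qed.

End Strength.
End JumpCounts.
Arguments zero_counts {b}.
Arguments jumps : simpl never.

(** * The probability that finitely many returns precede level L *)

Lemma big_option (R : pzSemiRingType) (I : finType) (F : option I -> R) :
  \sum_o F o = F None + \sum_i F (Some i).
Proof.
rewrite (bigD1 None) //=; congr (_ + _).
rewrite (reindex_omap Some id) /=; last by case.
by apply: eq_bigl => i; rewrite eqxx.
Qed.

Section Harmonic.
Local Open Scope ring_scope.
Variables (R : realType) (b : nat).
Hypothesis b_gt0 : (0 < b)%N.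
Variables (p q : R).
Hypotheses (p01 : 0 <= p <= 1) (q0 : 0 <= q) (q1 : q < 1).
Implicit Types (h : seq (vertex b)) (x y v : vertex b) (d j k L n : nat).

Definition strength h x := if x \in h then q else p.

(** Probability that a walker entering [y] for [j] more visits, with [h] the
    vertices already visited, comes back each time without going [d] levels
    below [y]. *)
Fixpoint extinct d h y j : R :=
  if j is j'.+1 then
    if d is d'.+1 then
      first_visit q (strength h y)
        (fun z => \prod_(i < b) extinct d' h (i :: y) (z i)) j'.+1
    else 0
  else 1.

Definition extinct_sons d h y : counts b -> R :=
  fun z => \prod_(i < b) extinct d h (i :: y) (z i).

Lemma strength01 h x : 0 <= strength h x <= 1.
Proof. by rewrite /strength; case: ifP => // _; rewrite q0 ltW. Qed.

Lemma prod01 (I : Type) (r : seq I) (A : pred I) (f : I -> R) :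
  (forall i, 0 <= f i <= 1) -> 0 <= \prod_(i <- r | A i) f i <= 1.
Proof.
move=> f01; elim/big_ind: _ => //; first by rewrite ler01 lexx.
move=> u v /andP[u0 u1] /andP[v0 v1]; rewrite mulr_ge0 //=.
by rewrite -(mulr1 1) ler_pM.
Qed.

Lemma extinct01 d h y j : 0 <= extinct d h y j <= 1.
Proof.
elim: d y j => [|d IH] y [|j] /=; rewrite ?ler01 ?lexx //.
by apply: first_visit_01 => // [|z]; [exact: strength01|exact: prod01].
Qed.

Lemma extinct_sons01 d h y z : 0 <= extinct_sons d h y z <= 1.
Proof. by apply: prod01 => i; exact: extinct01. Qed.

Lemma extinct_sons0 d h y : extinct_sons d h y zero_counts = 1.
Proof. by apply: big1 => i _; rewrite ffunE; case: d. Qed.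

Lemma extinctS d h y j : extinct d.+1 h y j.+1 =
  first_visit q (strength h y) (extinct_sons d h y) j.+1.
Proof. by []. Qed.

Lemma extinct_visited d h y j : y \in h ->
  extinct d.+1 h y j = jumps q j (extinct_sons d h y) zero_counts.
Proof.
move=> yh; case: j => [|j]; first by rewrite /jumps /= extinct_sons0.
rewrite extinctS /strength yh first_visit_same //.
by apply: bounded_01 => z; exact: extinct_sons01.
Qed.

Lemma extinct_local d h h' y j :
  (forall w, (w ++ y \in h) = (w ++ y \in h')) -> extinct d h y j = extinct d h' y j.
Proof.
elim: d y j => [|d IH] y [|j] // hh'; rewrite !extinctS /strength.
have := hh' [::]; rewrite /= => ->; congr first_visit; apply/funext => z.
by apply: eq_bigr => i _; apply: IH => w; rewrite -!cat_rcons.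
Qed.

Lemma extinct_unvisited d y j : extinct d [::] y j = extinct d [::] [::] j.
Proof.
elim: d y j => [|d IH] y [|j] //; rewrite !extinctS.
congr first_visit; apply/funext => z.
by apply: eq_bigr => i _; rewrite [LHS]IH [RHS]IH.
Qed.

(** Propagates to the root, which must be left [k] times, the value [g] of the
    subtree of [x], which contains the walker. If this subtree is to be entered
    [z i] more times, it has to be left [(z i).+1] times. *)
Fixpoint from_below L k h x (g : nat -> R) : R :=
  if x is i :: y then
    from_below L k h y (fun j =>
      jumps q j (fun z => g (z i).+1 *
        \prod_(i' | i' != i) extinct (L - size x) h (i' :: y) (z i')) zero_counts)
  else g k.

(** Value of the game when the walker stands at [x] and has not yet used the
    instruction found there; [h] is the past, [k] the number of steps of the
    root to itself that are still needed. *)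
Definition win L k x h := from_below L k h x (extinct (L - size x) h x).

Definition move x (o : option 'I_b) : vertex b :=
  if o is Some i then son x i else father x.

Definition move_prob h x (o : option 'I_b) : R :=
  if o is Some _ then strength h x / b%:R else 1 - strength h x.

Lemma siblings01 d h y i z :
  0 <= \prod_(i' | i' != i) extinct d h (i' :: y) (z i') <= 1.
Proof. by apply: prod01 => i'; exact: extinct01. Qed.

Lemma siblings_bounded d h y i (g : nat -> R) : is_bounded g ->
  is_bounded (fun z : counts b =>
    g (z i).+1 * \prod_(i' | i' != i) extinct d h (i' :: y) (z i')).
Proof.
move=> /bounded_ge0[M M0 gM]; exists M => z; rewrite normrM -[M]mulr1.
apply: ler_pM => //; have /andP[s0 s1] := siblings01 d h y i z.
by rewrite ger0_norm.
Qed.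

Lemma eq_from_below L k h x (g g' : nat -> R) : (0 < k)%N ->
  (forall j, g j.+1 = g' j.+1) -> from_below L k h x g = from_below L k h x g'.
Proof.
move=> k0 gg'; elim: x g g' gg' => [|i y IH] g g' gg' /=.
  by case: k k0 => // k _; exact: gg'.
by apply: IH => j; congr (jumps _ _ _ _); apply/funext => z; rewrite gg'.
Qed.

Lemma from_below_sum (I : finType) L k h x (w : I -> R) (g : I -> nat -> R) :
  (forall o, is_bounded (g o)) ->
  from_below L k h x (fun j => \sum_o w o * g o j)
  = \sum_o w o * from_below L k h x (g o).
Proof.
elim: x g => [|i y IH] g bg //; cbn [from_below]; rewrite -IH.
  congr (from_below _ _ _ _ _); apply/funext => j.
  rewrite (_ : (fun z => _) = fun z : counts b => \sum_o w o * (g o (z i).+1 *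
      \prod_(i' | i' != i) extinct (L - size (i :: y)) h (i' :: y) (z i'))).
    by rewrite jumps_sum // => o; exact: siblings_bounded.
  by apply/funext => z; rewrite big_distrl; apply: eq_bigr => o _; rewrite mulrA.
move=> o; have [M gM] := siblings_bounded (L - size (i :: y)) h y i (bg o).
by exists M => j; exact: jumps_norm.
Qed.

Lemma from_below01 L k h x (g : nat -> R) : (forall j, 0 <= g j <= 1) ->
  0 <= from_below L k h x g <= 1.
Proof.
elim: x g => [|i y IH] g g01; [exact: g01|]; cbn [from_below]; apply: IH => j.
apply: jumps_01 => // z; have /andP[s0 s1] := siblings01 (L - size (i :: y)) h y i z.
have /andP[g0 g1] := g01 (z i).+1.
by rewrite mulr_ge0 //= -[X in _ <= X]mulr1 ler_pM.
Qed.

(** The siblings of [x] and of its ancestors root subtrees that do not contain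
    [x], so a visit to [x] does not change their values. *)
Lemma from_below_visit L k h x w y (g : nat -> R) : x = w ++ y ->
  from_below L k (x :: h) y g = from_below L k h y g.
Proof.
elim: y w g => [|i y IH] w g // xE; cbn [from_below].
rewrite (IH (rcons w i)) ?cat_rcons //; congr (from_below _ _ _ _ _).
apply/funext => j; congr (jumps _ _ _ _); apply/funext => z; congr (_ * _).
apply: eq_bigr => i' ii'; apply: extinct_local => v; rewrite inE.
suff /negPf -> : v ++ i' :: y != x by [].
rewrite xE; apply/eqP => e.
have sz : size v == size w.
  by rewrite -(eqn_add2r (size (i :: y))) -[X in _ == X]size_cat -e size_cat.
by move/eqP: e; rewrite eqseq_cat ?(eqP sz) // eqseq_cons (negPf ii') andbF.
Qed.

Lemma win01 L k x h : 0 <= win L k x h <= 1.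
Proof. by apply: from_below01 => j; exact: extinct01. Qed.

Lemma win_root0 L h : win L 0 [::] h = 1.
Proof. by rewrite /win /=; case: (L - 0)%N. Qed.

Definition root_loop x (o : option 'I_b) : bool := (x == [::]) && (o == None).

(** The value is linear in what happens in the subtree of [x], so it can be
    conditioned on the instruction found at [x]. A step to the son [i] adds one
    to the count of [i]; a step to the father leaves [x] with one return less.
    Read from the new position, these are the values of the two next states. *)
Lemma win_harmonic L k x h : (0 < k)%N -> (size x < L)%N -> father x \in x :: h ->
  win L k x h = \sum_o move_prob h x o *
                  win L (k - root_loop x o) (move x o) (x :: h).
Proof.
move=> k0 xL fx; rewrite {1}/win.
have -> : (L - size x = (L - size x).-1.+1)%N by rewrite prednK // subn_gt0.
set d := (L - size x).-1.
have dE : d = (L - (size x).+1)%N by rewrite subnS.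
have sonsE i : extinct d (x :: h) (i :: x) = extinct d h (i :: x).
  apply/funext => j; apply: extinct_local => w; rewrite inE.
  suff /negPf -> : w ++ i :: x != x by [].
  apply/eqP => /(congr1 size)/eqP.
  by rewrite size_cat /= addnS -addSn -[X in _ == X]add0n eqn_add2r.
pose F := extinct_sons d h x.
have bF : is_bounded F by apply: bounded_01 => z; exact: extinct_sons01.
pose g (o : option 'I_b) j : R :=
  if o is Some i then jumps q j F (incr i zero_counts) else jumps q j.-1 F zero_counts.
have bg o : is_bounded (g o).
  by case: bF => M FM; exists M => j; case: o => [i|]; exact: jumps_norm.
rewrite (@eq_from_below _ _ _ _ _ (fun j => \sum_o move_prob h x o * g o j)) //; last first.
  move=> j; rewrite extinctS big_option /= /first_visit /avg; congr (_ + _).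
  by rewrite mulrA big_distrr.
rewrite from_below_sum //; apply: eq_bigr => o _; congr (_ * _).
rewrite -(@from_below_visit L k h x [::] x) //.
case: o => [i|] /=.
  rewrite /root_loop andbF subn0 /win; cbn [from_below]; congr (from_below _ _ _ _ _).
  apply/funext => j; rewrite /g -jumps_incr.
  congr (jumps _ _ _ _); apply/funext => z.
  rewrite [size _]/= -dE sonsE /F /extinct_sons /= (bigD1 i) //= ffunE eqxx addn1.
  congr (_ * _); apply: eq_bigr => i' /negPf ii'.
  by rewrite ffunE ii' addn0 sonsE.
(* A step to the father [y] finds both [x] and [y] already visited. *)
have visited y : y \in x :: h -> (size y < L)%N -> extinct (L - size y) (x :: h) y
    = fun j => jumps q j (extinct_sons (L - (size y).+1) (x :: h) y) zero_counts.
  move=> yh yL; apply/funext => j; rewrite -extinct_visited // subnS prednK //.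
  by rewrite subn_gt0.
have FE : extinct_sons d (x :: h) x = F.
  by apply/funext => z; apply: eq_bigr => i _; rewrite sonsE.
case: x @d dE sonsE @F bF @g bg FE xL fx visited
  => [|i y] d dE sonsE F bF g bg FE xL fx visited.
  have -> : win L (k - root_loop [::] None) [::] ([::] :: h)
            = extinct (L - size ([::] : vertex b)) ([::] :: h) [::] (k - 1) by [].
  by rewrite visited ?mem_head // -dE FE subn1.
rewrite [father _]/= /root_loop subn0 /win; cbn [from_below].
rewrite (visited y) //; last exact: ltnW.
congr (from_below _ _ _ _ _); apply/funext => j.
congr (jumps _ _ _ _); apply/funext => z.
rewrite /extinct_sons [RHS](bigD1 i) //=; congr (_ * _).
by rewrite (visited (i :: y)) ?mem_head // -dE FE.
Qed.

End Harmonic.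

(** * The geometric law is a left eigenvector of the one-son kernel *)

Section Spectrum.
Local Open Scope ring_scope.
Variables (R : realType) (b : nat).
Hypothesis b_gt0 : (0 < b)%N.
Variables (p q : R).
Hypotheses (q0 : 0 < q) (q1 : q < 1).
Implicit Types (F : counts b -> R) (z : counts b) (i : 'I_b) (t : R) (g : nat -> R).

Let bR_gt0 : 0 < b%:R :> R. Proof. by rewrite ltr0n. Qed.

(** Mean number of steps to a given son per step to the father. *)
Definition son_mean : R := q / (b%:R * (1 - q)).
Local Notation m := son_mean.

Lemma son_mean_gt0 : 0 < m.
Proof. by rewrite divr_gt0 // mulr_gt0 // subr_gt0. Qed.

Let qbE : q / b%:R = m * (1 - q).
Proof.
rewrite /son_mean; field.
by rewrite (gt_eqF bR_gt0) subr_eq0 (gt_eqF q1).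
Qed.

Definition depends_on i F := forall z z', z i = z' i -> F z = F z'.

Lemma depends_on_avg i F z : depends_on i F ->
  avg F z = b%:R^-1 * F (incr i z) + (1 - b%:R^-1) * F z.
Proof.
move=> dF; rewrite /avg (bigD1 i) //= (eq_bigr (fun=> F z)); last first.
  by move=> i' ii'; apply: dF; rewrite ffunE eq_sym (negPf ii') addn0.
rewrite sumr_const cardC1 card_ord -[X in _ + X]mulr_natl.
rewrite -subn1 natrB // mulrDr mulrA mulrBr mulVf ?(gt_eqF bR_gt0) //.
by rewrite mulr1.
Qed.

Lemma depends_on_jumps i F k : depends_on i F -> depends_on i (jumps q k F).
Proof.
elim: k => // k IH /IH {}IH; rewrite jumpsSE => z z' zz'.
rewrite /until_father; congr (_ * geosum _ _); apply/funext => n.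
elim: n z z' zz' => [|n IHn] z z' zz' /=; first exact: IH.
by rewrite !(depends_on_avg (i := i)) // (IHn z z') // (IHn (incr i z) (incr i z'))
  // !ffunE zz'.
Qed.

Definition one_son i g : counts b -> R := fun z => g (z i).

Lemma one_son_bounded i g : is_bounded g -> is_bounded (one_son i g).
Proof. by case=> M gM; exists M => z; exact: gM. Qed.

(** The generating function of the number of steps to one son before a step to
    the father is a Moebius map, with fixed points [1] and [m^-1]. Therefore the
    kernel maps geometric measures to geometric measures: the ratio [t] becomes
    [image_ratio t], and the ratio [m] is preserved. *)
Definition image_ratio t : R := m / (1 + m - t).

(** The kernel, cookie included, sends the geometric measure of ratio [t] to
    [image_mass t] times that of ratio [image_ratio t]. *)
Definition image_mass t : R :=
  ((1 - p) * t * image_ratio t + p / b%:R + (p - p / b%:R) * image_ratio t)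
  / (1 + m - t).

Lemma image_ratio01 t : t < 1 -> 0 < image_ratio t < 1.
Proof.
move=> t1; have m0 := son_mean_gt0; rewrite divr_gt0 //=; last by lra.
by rewrite ltr_pdivrMr; lra.
Qed.

(** The left action of the kernel on a geometric measure, tested against [g]. By
    the recursion on the number of returns, the sums [c n] over all [j] satisfy
    a linear recursion in the starting count [n], whose only bounded solution is
    a geometric sum of ratio [image_ratio t]. The hypothesis [g 0 = 0] discards
    the sons that are never entered. *)
Lemma geosum_one_son i g t : 0 <= t < 1 -> is_bounded g -> g 0%N = 0 ->
  geosum t (fun j => first_visit q p (one_son i g) j.+1)
  = image_mass t * geosum (image_ratio t) (fun k => g k.+1).
Proof.
move=> /andP[t0 t1] bg g0.
have q0' : 0 <= q by exact: ltW.
have m0 := son_mean_gt0.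
pose F := one_son i g; have bF : is_bounded F by exact: one_son_bounded.
have dF : depends_on i F by move=> z z'; rewrite /F /one_son => ->.
(* [Z n] stands for any counts that give [n] to the son [i]. *)
pose Z n : counts b := [ffun=> n].
pose N j n := jumps q j F (Z n).
have NE j n z : z i = n -> jumps q j F z = N j n.
  by move=> zn; apply: (depends_on_jumps j dF); rewrite ffunE.
have [M NM] : exists M : R, forall j n, `|N j n| <= M.
  by case: bF => M FM; exists M => j n; exact: jumps_norm.
have bN n : is_bounded (fun j => N j n) by exists M.
have bNS n : is_bounded (fun j => N j.+1 n) by exists M.
have avgN j n : avg (jumps q j F) (Z n)
    = b%:R^-1 * N j n.+1 + (1 - b%:R^-1) * N j n.
  rewrite (depends_on_avg (i := i)); last exact: depends_on_jumps.
  by rewrite (NE _ n.+1) // !ffunE eqxx addn1.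
have NS j n : N j.+1 n = (1 - q) * N j n
    + 1 * (q * b%:R^-1 * N j.+1 n.+1 + q * (1 - b%:R^-1) * N j.+1 n).
  by rewrite {1}/N jumpsS // avgN -/(N j n); ring.
pose a n := geosum t (fun j => N j n); pose c n := geosum t (fun j => N j.+1 n).
have aE n : a n = g n + t * c n.
  rewrite /a geosumS //; congr (_ + _).
  by rewrite /N /jumps /= /F /one_son ffunE.
have cE n : c n = (1 - q) * a n + (q * b%:R^-1 * c n.+1 + q * (1 - b%:R^-1) * c n).
  rewrite {1}/c; under [in LHS]eq_fun do rewrite NS.
  rewrite geosum_lin //; last exact: bounded_lin.
  by rewrite geosum_lin // mul1r.
have q1' : 1 - q != 0 by rewrite subr_eq0 gt_eqF.
have mt : 1 + m - t != 0 by rewrite gt_eqF //; lra.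
have cS n : c n = (1 + m - t)^-1 * g n + image_ratio t * c n.+1.
  have e : (1 + m - t) * c n = g n + m * c n.+1.
    apply: (mulfI q1'); apply/subr0_eq.
    transitivity ((c n - ((1 - q) * a n
        + (q * b%:R^-1 * c n.+1 + q * (1 - b%:R^-1) * c n)))
        + (m * (1 - q) - q / b%:R) * (c n - c n.+1)); first by rewrite aE; ring.
    by rewrite -cE qbE !subrr mul0r addr0.
  by rewrite -[LHS](mulKf mt) e /image_ratio; ring.
have /andP[r0 r1] := image_ratio01 t1.
have c1 : c 1%N = (1 + m - t)^-1 * geosum (image_ratio t) (fun k => g k.+1).
  have bgS : is_bounded (fun k => g k.+1) by case: bg => ? ?; eexists.
  rewrite -[LHS]/((fun n => c n.+1) 0%N).
  rewrite (geosum_uniq (ltW r0) r1 (a := fun k => (1 + m - t)^-1 * g k.+1)) //.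
  - have := geosum_lin (ltW r0) r1 (1 + m - t)^-1 0 bgS bgS.
    by under eq_fun do rewrite mul0r addr0; rewrite mul0r addr0.
  - by have := bounded_lin (1 + m - t)^-1 0 bgS bgS; under eq_fun do rewrite mul0r addr0.
  - by exists (M / (1 - t)) => n; exact: geosum_norm.
have c0 : c 0%N = image_ratio t * c 1%N by rewrite cS g0 mulr0 add0r.
have -> : (fun j => first_visit q p F j.+1) = (fun j => (1 - p) * N j 0%N
    + 1 * (p * b%:R^-1 * N j.+1 1%N + p * (1 - b%:R^-1) * N j.+1 0%N)).
  apply/funext => j; rewrite /first_visit -[zero_counts]/(Z 0%N) avgN /= /N; ring.
rewrite geosum_lin //; last exact: bounded_lin.
rewrite geosum_lin // -/(a _) -/(c _) -/(c _) aE c0 c1 g0 /image_mass; ring.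
Qed.

Lemma image_ratio_mean : image_ratio m = m.
Proof. by rewrite /image_ratio addrK divr1. Qed.

(** The geometric measure of ratio [m] is a left eigenvector. *)
Lemma image_mass_mean : image_mass m = lambda1 b p q.
Proof.
rewrite /image_mass image_ratio_mean /lambda1 addrK divr1 -/m; field.
by rewrite gt_eqF.
Qed.

End Spectrum.

(** * Extinction in the limit of deep trees *)

Section Elementary.
Local Open Scope ring_scope.
Variable R : realType.

Lemma compl01 (x : R) : 0 <= x <= 1 -> 0 <= 1 - x <= 1.
Proof. by rewrite subr_ge0 lerBlDr lerDl andbC. Qed.

Lemma prod_compl_bounds (I : Type) (r : seq I) (x : I -> R) :
  (forall i, 0 <= x i <= 1) ->
  let S := \sum_(i <- r) x i in
  [/\ 0 <= S, 1 - S <= \prod_(i <- r) (1 - x i) &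
      \prod_(i <- r) (1 - x i) <= 1 - S + S ^+ 2].
Proof.
move=> x01 S; rewrite {}/S; elim: r => [|i r [S0 lo hi]].
  by rewrite !big_nil; split; rewrite ?lexx //; lra.
rewrite !big_cons; have /andP[x0 x1] := x01 i.
move: (\sum_(_ <- _) _) (\prod_(_ <- _) _) S0 lo hi => S P S0 lo hi.
split; nra.
Qed.

End Elementary.

Section Survival.
Local Open Scope ring_scope.
Variables (R : realType) (b : nat).
Hypothesis b_gt1 : (1 < b)%N.
Variables (p q : R).
Hypotheses (p01 : 0 <= p < 1) (q0 : 0 < q) (q1 : q < 1).
Implicit Types (d j k n A : nat) (t : R).

Let b_gt0 : (0 < b)%N. Proof. exact: ltnW. Qed.
Let q0' : 0 <= q. Proof. exact: ltW. Qed.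
Let p01' : 0 <= p <= 1. Proof. by case/andP: p01 => -> /ltW. Qed.
Let bR_gt0 : 0 < b%:R :> R. Proof. by rewrite ltr0n. Qed.

(** Probability that a subtree not visited before is explored down to [d]
    levels below its root in the course of [j] visits. *)
Definition survive d j : R := 1 - extinct p q d [::] ([::] : vertex b) j.
Local Notation m := (son_mean b q).

Lemma survive01 d j : 0 <= survive d j <= 1.
Proof.
by apply: compl01; exact: extinct01.
Qed.

Lemma survive_j0 d : survive d 0 = 0.
Proof. by rewrite /survive; case: d => [|d]; rewrite /= subrr. Qed.

Lemma survive_d0 j : survive 0 j.+1 = 1.
Proof. by rewrite /survive /= subr0. Qed.

Definition some_son_survives d (z : counts b) : R :=
  1 - \prod_(i < b) (1 - survive d (z i)).

Lemma some_son_survives01 d z : 0 <= some_son_survives d z <= 1.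
Proof.
by apply: compl01; apply: prod01 => i; apply: compl01; exact: survive01.
Qed.

Lemma surviveS d j : survive d.+1 j.+1 = first_visit q p (some_son_survives d) j.+1.
Proof.
rewrite /survive extinctS /strength in_nil.
have bE : is_bounded (extinct_sons p q d [::] ([::] : vertex b)).
  by apply: bounded_01 => z; exact: extinct_sons01.
rewrite (_ : some_son_survives d = fun z => 1 * 1 + -1 * extinct_sons p q d [::] [::] z).
  rewrite first_visit_lin //; last exact: bounded_cst.
  by rewrite first_visit_cst // mul1r mulN1r.
apply/funext => z; rewrite /some_son_survives mul1r mulN1r; congr (_ - _).
by apply: eq_bigr => i _; rewrite [RHS]extinct_unvisited // /survive opprB addrC subrK.
Qed.

Lemma survive_decr d j : survive d.+1 j <= survive d j.
Proof.
elim: d j => [|d IH] [|j]; rewrite ?survive_j0 //.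
  by rewrite survive_d0; case/andP: (survive01 1 j.+1).
rewrite !surviveS; apply: ler_first_visit => // [||z].
- by apply: bounded_01; exact: some_son_survives01.
- by apply: bounded_01; exact: some_son_survives01.
rewrite lerD2l lerN2; apply: ler_prod => i _; rewrite lerD2l lerN2 IH andbT subr_ge0.
by case/andP: (survive01 d (z i)).
Qed.

Lemma survive_anti d d' j : (d <= d')%N -> survive d' j <= survive d j.
Proof.
move=> /subnKC <-; elim: (d' - d)%N => [|n IH]; rewrite ?addn0 // addnS.
exact: le_trans (survive_decr _ _) IH.
Qed.

Lemma first_visit_bounded (F : counts b -> R) :
  is_bounded F -> is_bounded (fun j => first_visit q p F j.+1).
Proof.
case=> M FM; exists (`|1 - p| * M + `|p| * M) => j; rewrite /first_visit.
apply: le_trans (ler_normD _ _) _; rewrite (normrM (1 - p)) (normrM p).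
apply: lerD; apply: ler_wpM2l => //; first exact: jumps_norm.
by apply: avg_norm => // z; exact: jumps_norm.
Qed.

Lemma geosum_sum_sons t (g : nat -> R) : 0 <= t < 1 -> is_bounded g -> g 0%N = 0 ->
  is_bounded (fun z : counts b => \sum_(i < b) g (z i)) /\
  geosum t (fun j => first_visit q p (fun z : counts b => \sum_(i < b) g (z i)) j.+1)
  = b%:R * image_mass b p q t * geosum (image_ratio b q t) (fun k => g k.+1).
Proof.
move=> t01 bg g0; have [t0 t1] := andP t01.
have bo i : is_bounded (one_son i g) by exact: one_son_bounded.
suff H : forall r : seq 'I_b, is_bounded (fun z : counts b => \sum_(i <- r) g (z i)) /\
  geosum t (fun j => first_visit q p (fun z : counts b => \sum_(i <- r) g (z i)) j.+1)
  = (size r)%:R * image_mass b p q t * geosum (image_ratio b q t) (fun k => g k.+1).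
  have [bS ->] := H (index_enum 'I_b); split=> //.
  by rewrite [X in size X]unlock -enumT size_enum_ord.
elim=> [|i r [bS IH]].
  split; first by under eq_fun do rewrite big_nil; exact: bounded_cst.
  rewrite (_ : (fun j => _) = fun=> 0) ?geosum_cst ?mul0r //.
  apply/funext => j; rewrite (_ : (fun z => _) = fun=> 0) ?first_visit_cst //.
  by apply/funext => z; rewrite big_nil.
have E : (fun z : counts b => \sum_(i0 <- i :: r) g (z i0))
       = (fun z => 1 * one_son i g z + 1 * \sum_(i0 <- r) g (z i0)).
  by apply/funext => z; rewrite big_cons !mul1r.
split; first by rewrite E; exact: bounded_lin.
rewrite E; under eq_fun do rewrite first_visit_lin //.
rewrite geosum_lin //; try exact: first_visit_bounded.
rewrite geosum_one_son // IH /= -natr1; ring.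
Qed.

(** For [t = m], the pairing of the survival probabilities with the left
    eigenvector of the kernel. *)
Definition mass t d : R := geosum t (fun k => survive d k.+1).

Let sv_bounded d : is_bounded (survive d).
Proof. by apply: bounded_01; exact: survive01. Qed.

Let svS_bounded d : is_bounded (fun k => survive d k.+1).
Proof. exact: bounded_comp. Qed.

Let sss_bounded d : is_bounded (some_son_survives d).
Proof. by apply: bounded_01; exact: some_son_survives01. Qed.

Lemma massS t d :
  mass t d.+1 = geosum t (fun j => first_visit q p (some_son_survives d) j.+1).
Proof. by congr geosum; apply/funext => j; rewrite surviveS. Qed.

Lemma mass_ge0 t d : 0 <= t < 1 -> 0 <= mass t d.
Proof.
by move=> /andP[? ?]; apply: geosum_ge0 => // k; case/andP: (survive01 d k.+1).
Qed.

(** First-moment bound: some son survives with at most the expected number of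
    surviving sons as probability. *)
Lemma mass_step_le t d : 0 <= t < 1 ->
  mass t d.+1 <= b%:R * image_mass b p q t * mass (image_ratio b q t) d.
Proof.
move=> t01; have [t0 t1] := andP t01.
have [bS <-] := geosum_sum_sons t01 (sv_bounded d) (survive_j0 d).
rewrite massS; apply: ler_geosum => //; try exact: first_visit_bounded.
move=> j; apply: ler_first_visit => // z.
have [_ + _] := prod_compl_bounds (index_enum 'I_b) (fun i => survive01 d (z i)).
by rewrite /some_son_survives; lra.
Qed.

Lemma mass_step_ge t d : 0 <= t < 1 ->
  image_mass b p q t * mass (image_ratio b q t) d <= mass t d.+1.
Proof.
move=> t01; have [t0 t1] := andP t01; pose i0 := Ordinal b_gt0.
have bo := one_son_bounded i0 (sv_bounded d).
rewrite -(geosum_one_son b_gt0 p q0 q1 i0 t01 (sv_bounded d) (survive_j0 d)).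
rewrite massS; apply: ler_geosum => //; try exact: first_visit_bounded.
move=> j; apply: ler_first_visit => // z; rewrite /one_son /some_son_survives.
rewrite lerBrDr addrC -lerBrDr (bigD1 i0) //= -[X in _ <= X]mulr1.
have c01 i : 0 <= 1 - survive d (z i) <= 1 by apply: compl01; exact: survive01.
have /andP[c0 _] := c01 i0; apply: ler_wpM2l => //.
by have /andP[] := prod01 (index_enum 'I_b) (fun i => i != i0) c01.
Qed.

Section Subcritical.
Hypothesis m_lt1 : m < 1.

Let m01 : 0 <= m < 1. Proof. by rewrite m_lt1 ltW // son_mean_gt0. Qed.

Lemma jumps1_ge (F : counts b -> R) i n z : is_bounded F -> (forall z, 0 <= F z) ->
  (q / b%:R) ^+ n * jumps q 1 F (iter n (incr i) z) <= jumps q 1 F z.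
Proof.
move=> bF F0; elim: n z => [|n IH] z; first by rewrite mul1r.
have qb0 : 0 <= q / b%:R by rewrite divr_ge0 // ltW.
rewrite exprS -mulrA iterSr; apply: le_trans (ler_wpM2l qb0 (IH _)) _.
rewrite [X in _ <= X]jumpsS // ler_wpDl //.
  by rewrite mulr_ge0 ?subr_ge0 ?(ltW q1) // jumps_ge0.
rewrite -mulrA ler_wpM2l // /avg ler_wpM2l ?invr_ge0 ?(ltW bR_gt0) //.
rewrite (bigD1 i) //= lerDl; apply: sumr_ge0 => i' _; exact: jumps_ge0.
Qed.

Lemma iter_incr (i i' : 'I_b) n z :
  iter n (incr i) z i' = (z i' + (if i' == i then n else 0))%N.
Proof.
elim: n => [|n IH] /=; first by case: ifP; rewrite addn0.
by rewrite ffunE IH -addnA; case: eqP; rewrite ?addn1 ?addn0.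
Qed.

Lemma sum_ge_pair (x : 'I_b -> R) i0 i1 : i0 != i1 -> (forall i, 0 <= x i <= 1) ->
  1 - \prod_(i < b) (1 - x i) <= \sum_(i < b) x i - x i0 * x i1.
Proof.
move=> i01 x01; have i10 : (i1 != i0) by rewrite eq_sym.
rewrite [\prod_(i < b) _](bigD1 i0) // [\prod_(i < b | _) _](bigD1 i1) //=.
rewrite [\sum_(i < b) _](bigD1 i0) // [\sum_(i < b | _) _](bigD1 i1) //=.
have [S0 lo _] := prod_compl_bounds [seq i <- index_enum 'I_b | (i != i0) && (i != i1)] x01.
move: S0 lo; rewrite !big_filter.
have /andP[P0 P1] : 0 <= \prod_(i < b | (i != i0) && (i != i1)) (1 - x i) <= 1.
  by apply: prod01 => i; exact: compl01.
have /andP[a0 a1] := x01 i0; have /andP[c0 c1] := x01 i1.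
move: (\sum_(_ <- _ | _) _) (\prod_(_ <- _ | _) _) P0 P1 => S P P0 P1 S0 lo.
have : 0 <= (1 - (1 - x i0) * (1 - x i1)) * (1 - P).
  rewrite mulr_ge0 ?subr_ge0 //; nra.
nra.
Qed.

(** The masses cannot increase. Each step loses, beyond the first-moment
    bound, the probability that two sons both survive; a positive limit of
    [survive d k] would make this loss bounded below. This is what settles the
    critical case, and where a second son is needed. *)
Lemma survive_subcritical k e : b%:R * lambda1 b p q <= 1 -> 0 < e ->
  exists d, survive d k < e.
Proof.
move=> crit e0; apply/not_existsP => sv.
have {}sv d : e <= survive d k by rewrite leNgt; apply/negP => /(sv d).
pose i0 : 'I_b := Ordinal b_gt0; pose i1 : 'I_b := Ordinal b_gt1.
have i01 : i0 != i1 by [].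
pose F d (z : counts b) := survive d (z i0) * survive d (z i1).
have F01 d z : 0 <= F d z <= 1.
  have /andP[a0 a1] := survive01 d (z i0); have /andP[c0 c1] := survive01 d (z i1).
  by rewrite mulr_ge0 //= -[X in _ <= X]mulr1 ler_pM.
have bF d : is_bounded (F d) by apply: bounded_01.
(* A vertex entered twice may first send the walker back, then [k] times to
   each of [i0] and [i1], then back: this is the product without [m] and
   [e ^+ 2]. The factor [m] is the weight of two visits in [mass m]. *)
pose c := m * ((1 - p) * ((q / b%:R) ^+ k * ((q / b%:R) ^+ k * ((1 - q) * e ^+ 2)))).
have c0 : 0 < c.
  have /andP[_ p1] := p01.
  have qb : 0 < (q / b%:R) ^+ k by rewrite exprn_gt0 // divr_gt0.
  have p1' : 0 < 1 - p by rewrite subr_gt0.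
  have q1' : 0 < 1 - q by rewrite subr_gt0.
  by rewrite /c; do 4!rewrite mulr_gt0 ?son_mean_gt0 //; rewrite mulr_gt0 ?exprn_gt0.
have loss d : c <= geosum m (fun j => first_visit q p (F d) j.+1).
  pose z := iter k (incr i1) (iter k (incr i0) zero_counts).
  have Fz : F d z = survive d k ^+ 2.
    by rewrite /F /z !iter_incr !ffunE !eqxx [i1 == i0]eq_sym (negPf i01) !addn0 add0n expr2.
  have F0 z' : 0 <= F d z' by case/andP: (F01 d z').
  have J1 : (1 - q) * F d z <= jumps q 1 (F d) z.
    rewrite jumpsS // lerDl mulr_ge0 //.
    rewrite -[X in X <= _](avg_cst b_gt0 0 z); apply: ler_avg => z'.
    exact: jumps_ge0.
  have qb0 n : 0 <= (q / b%:R) ^+ n by rewrite exprn_ge0 // divr_ge0 // ltW.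
  have J2 := jumps1_ge i1 k (iter k (incr i0) zero_counts) (bF d) F0.
  have J3 := jumps1_ge i0 k zero_counts (bF d) F0.
  have /andP[p0 p1] := p01.
  have m0 : 0 <= m by case/andP: m01.
  apply: le_trans (geosum_ge m0 m_lt1 1 (first_visit_bounded (bF d)) _); last first.
    by move=> j; apply: first_visit_ge0.
  rewrite /c expr1 ler_wpM2l // /first_visit ler_wpDr //.
    rewrite mulr_ge0 // -[X in X <= _](avg_cst b_gt0 0 zero_counts).
    by apply: ler_avg => z'; exact: jumps_ge0.
  rewrite ler_wpM2l ?subr_ge0 ?(ltW p1) //; apply: le_trans J3.
  rewrite ler_wpM2l //; apply: le_trans J2; rewrite ler_wpM2l //.
  apply: le_trans J1; rewrite ler_wpM2l ?subr_ge0 ?(ltW q1) // Fz.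
  by rewrite ler_pXn2r ?nnegrE ?(ltW e0) //; case/andP: (survive01 d k).
have step d : mass m d.+1 <= mass m d - c.
  have [m0 _] := andP m01.
  have [bS] := geosum_sum_sons m01 (sv_bounded d) (survive_j0 d).
  rewrite image_ratio_mean // image_mass_mean // -/(mass m d) => E.
  have bSF := bounded_lin 1 (-1) bS (bF d).
  have : mass m d.+1 <= 1 * geosum m (fun j => first_visit q p
            (fun z : counts b => \sum_(i < b) survive d (z i)) j.+1)
          + -1 * geosum m (fun j => first_visit q p (F d) j.+1).
    rewrite massS -geosum_lin //; try exact: first_visit_bounded.
    under [in X in _ <= X]eq_fun do rewrite -first_visit_lin //.
    apply: ler_geosum => //; try exact: first_visit_bounded.
    move=> j; apply: ler_first_visit => // z.
    have := sum_ge_pair i01 (fun i => survive01 d (z i)).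
    by rewrite /some_son_survives /F; lra.
  rewrite E; have := loss d; have := mass_ge0 d m01; nra.
have decr d : mass m d <= mass m 0 - d%:R * c.
  elim: d => [|d IH]; first by rewrite mul0r subr0.
  by have := step d; rewrite -natr1; lra.
have : 0 <= mass m 0 / c by rewrite divr_ge0 ?mass_ge0 // ltW.
move=> /archi_boundP; rewrite ltr_pdivrMr // => H.
have := decr (Num.bound (mass m 0 / c)).
have := mass_ge0 (Num.bound (mass m 0 / c)) m01; lra.
Qed.

(** Tightness, uniformly in the depth. A ratio [t > m] is mapped to a smaller
    one, so the heavier mass [mass t] contracts relative to [mass m] in one
    step; hence few of the surviving subtrees are visited often. *)
Lemma mass_tight t : m < t < 1 -> 0 < lambda1 b p q ->
  exists2 C, 0 < C & forall d, mass t d <= C * mass m d.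
Proof.
move=> /andP[mt t1] l0; have m0 := son_mean_gt0 b_gt0 q0 q1.
have t0 : 0 < t by exact: lt_trans mt.
have t01 : 0 <= t < 1 by rewrite ltW.
have /andP[r0 r1] := image_ratio01 b_gt0 q0 q1 t1.
set r := image_ratio b q t in r0 r1.
have rt : r < t.
  rewrite /r /image_ratio ltr_pdivrMr; last by lra.
  rewrite -subr_gt0 (_ : _ - _ = (t - m) * (1 - t)); last by ring.
  by rewrite mulr_gt0 ?subr_gt0.
pose K := image_mass b p q t.
have K0 : 0 <= K.
  rewrite /K /image_mass -/r divr_ge0 //; last by lra.
  have /andP[p0 /ltW p1] := p01.
  have pb : p / b%:R <= p by rewrite ler_pdivrMr // ler_peMr // ler1n.
  have pb0 : 0 <= p / b%:R by rewrite divr_ge0 // ltW.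
  have [t0' r0'] := (ltW t0, ltW r0).
  have a1 : 0 <= (1 - p) * t * r.
    by apply: mulr_ge0 => //; apply: mulr_ge0 => //; rewrite subr_ge0.
  have a2 : 0 <= (p - p / b%:R) * r by apply: mulr_ge0 => //; rewrite subr_ge0.
  by rewrite addr_ge0 // addr_ge0.
pose l := lambda1 b p q; rewrite -/l in l0.
(* This [e] makes [b * K * e] at most [l / 2], so that the bound by [C] below
   reproduces itself from one depth to the next. *)
have e0 : 0 < l / (2 * (b%:R * K + 1)).
  by rewrite divr_gt0 // mulr_gt0 // ltr_wpDl // mulr_ge0 // (ltW bR_gt0).
have rt0 : 0 <= r / t by rewrite divr_ge0 // ltW.
have rt1 : r / t < 1 by rewrite ltr_pdivrMr // mul1r.
have [n] := geometric_small rt0 rt1 1 e0; rewrite mulr1.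
set e := _ / _ in e0 * => rtn.
pose c := (m ^+ n)^-1; have c0 : 0 < c by rewrite invr_gt0 exprn_gt0.
have powers k : r ^+ k <= e * t ^+ k + c * m ^+ k.
  have [nk|kn] := leqP n k.
    apply: ler_wpDr; first by rewrite mulr_ge0 ?exprn_ge0 // ltW.
    rewrite -ler_pdivrMr ?exprn_gt0 // -expr_div_n.
    apply: le_trans rtn; rewrite -(subnKC nk) exprD ler_piMr ?exprn_ge0 //.
    by rewrite exprn_ile1 // ltW.
  apply: ler_wpDl; first by rewrite mulr_ge0 ?exprn_ge0 // ltW.
  apply: (@le_trans _ _ 1); first by rewrite exprn_ile1 // ltW.
  rewrite /c -(subnKC (ltnW kn)) exprD invfM mulrAC mulVf ?mul1r.
    by rewrite invf_ge1 ?exprn_gt0 // exprn_ile1 // ltW.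
  by rewrite expf_neq0 // gt_eqF.
have contract d : mass r d <= e * mass t d + c * mass m d.
  apply: ler_geosum3 => // [|k]; first by rewrite ltW.
  have /andP[s0 _] := survive01 d k.+1.
  rewrite !mulrA -mulrDl; exact: ler_wpM2r.
pose C := (1 - t)^-1 + 2 * b%:R * K * c / l.
have C1 : 0 < (1 - t)^-1 by rewrite invr_gt0 subr_gt0.
have C2 : 0 <= 2 * b%:R * K * c / l.
  by rewrite divr_ge0 ?(ltW l0) // mulr_ge0 ?(ltW c0) // mulr_ge0.
exists C; first by rewrite /C ltr_pwDl.
elim=> [|d IH].
  rewrite /mass (_ : (fun k => survive 0 k.+1) = fun=> 1); last first.
    by apply/funext => k; rewrite survive_d0.
  rewrite (geosum_cst (ltW t0) t1) (geosum_cst (ltW m0) m_lt1) !mul1r.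
  have m1 : 1 <= (1 - m)^-1 by rewrite invf_ge1 ?subr_gt0 // lerBlDr lerDl ltW.
  apply: le_trans (ler_wpM2l _ m1); last by rewrite addr_ge0 // ltW.
  by rewrite mulr1 lerDl.
have up := mass_step_le d t01; rewrite -/K -/r in up.
have lo := mass_step_ge d m01.
rewrite image_ratio_mean // image_mass_mean // -/l in lo.
have a0 := mass_ge0 d m01; have co := contract d.
have bK0 : 0 <= b%:R * K by rewrite mulr_ge0 // ltW.
apply: (@le_trans _ _ (C * (l * mass m d))); last first.
  by rewrite ler_wpM2l // addr_ge0 // ltW.
apply: le_trans up _; apply: le_trans (ler_wpM2l bK0 co) _.
apply: (@le_trans _ _ (b%:R * K * (e * C + c) * mass m d)).
  rewrite -[X in _ <= X]mulrA; apply: ler_wpM2l => //; rewrite mulrDl lerD2r -(mulrA e).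
  by apply: ler_wpM2l => //; exact: ltW.
rewrite [X in _ <= X]mulrA ler_wpM2r //.
have h1 : b%:R * K * e <= l / 2.
  have X0 : b%:R * K + 1 != 0 by rewrite gt_eqF // ltr_wpDl.
  rewrite -subr_ge0 (_ : _ - _ = e) ?(ltW e0) //.
  by rewrite /e; field.
have h2 : b%:R * K * c <= l / 2 * C.
  have -> : l / 2 * C = l / 2 * (1 - t)^-1 + b%:R * K * c.
    by rewrite /C; field; rewrite !lt0r_neq0 // subr_gt0.
  by rewrite lerDr mulr_ge0 ?(ltW C1) // divr_ge0 // ltW.
have C0 : 0 <= C by rewrite addr_ge0 // ltW.
have := ler_wpM2r C0 h1; nra.
Qed.

(** If every subtree died out in the limit, the pairs of surviving sons would
    become negligible and the masses would eventually grow. *)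
Lemma survive_supercritical : 1 < b%:R * lambda1 b p q ->
  exists k e, 0 < e /\ forall d, e <= survive d k.
Proof.
move=> sup; apply/not_existsP => dies.
have small k e : 0 < e -> exists d, forall d', (d <= d')%N -> survive d' k <= e.
  move=> e0; apply/not_existsP => H; apply: (dies k); exists e; split=> // d.
  rewrite leNgt; apply/negP => /ltW sd; apply: (H d) => d' dd'.
  exact: le_trans (survive_anti k dd') sd.
have {dies}small A e : 0 < e ->
    exists d, forall d' k, (d <= d')%N -> (k <= A)%N -> survive d' k <= e.
  move=> e0; elim: A => [|A [d1 IH]].
    have [d H] := small 0%N e e0; exists d => d' k dd'.
    by rewrite leqn0 => /eqP ->; exact: H.
  have [d2 H] := small A.+1 e e0; exists (maxn d1 d2) => d' k.
  rewrite geq_max => /andP[h1 h2]; rewrite leq_eqVlt => /orP[/eqP ->|]; first exact: H.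
  by rewrite ltnS; exact: IH.
pose mu := b%:R * lambda1 b p q; rewrite -/mu in sup.
have l0 : 0 < lambda1 b p q.
  by rewrite -(pmulr_rgt0 _ bR_gt0); exact: lt_trans sup.
have m0 := son_mean_gt0 b_gt0 q0 q1.
pose t := (m + 1) / 2.
have [mt t1] : m < t /\ t < 1 by have [? ?] := midf_lt m_lt1.
have t0 : 0 < t by exact: lt_trans mt.
have t01 : 0 <= t < 1 by rewrite ltW.
have mt1 : m < t < 1 by rewrite mt.
have [C C0 tight] := mass_tight mt1 l0.
(* Each of the two error terms, from sons entered at most [A] times and from
   those entered more often, then costs at most [(mu - 1) / 2] of the growth. *)
pose e := (mu - 1) / (2 * b%:R * mu).
have mu0 : 0 < mu by exact: lt_trans sup.
have bR1 : 1 <= b%:R :> R by rewrite ler1n.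
have den : 0 < 2 * b%:R * mu by rewrite !mulr_gt0.
have e0 : 0 < e by rewrite divr_gt0 ?subr_gt0.
have emu : b%:R * (mu * e) = (mu - 1) / 2.
  by rewrite /e; field; rewrite !gt_eqF.
have e12 : e <= 1 / 2.
  rewrite /e ler_pdivrMr //.
  have : mu <= b%:R * mu by rewrite ler_peMl // ltW.
  lra.
have mt0 : 0 <= m / t by rewrite divr_ge0 // ltW.
have mtlt : m / t < 1 by rewrite ltr_pdivrMr // mul1r.
have [A HA] := geometric_small mt0 mtlt C e0.
pose tail d k : R := if (A < k)%N then survive d k else 0.
have tail01 d k : 0 <= tail d k <= 1.
  by rewrite /tail; case: ifP => _; rewrite ?survive01 // lexx ler01.
have tail_bounded d : is_bounded (tail d) by exact: bounded_01.
have tailS_bounded d : is_bounded (fun k => tail d k.+1) by exact: bounded_comp.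
have tail_le d : geosum m (fun k => tail d k.+1) <= e * mass m d.
  have : geosum m (fun k => tail d k.+1) <= (m / t) ^+ A * mass t d + 0 * mass t d.
    apply: ler_geosum3 => // k; rewrite mul0r addr0 /tail ltnS.
    have /andP[s0 _] := survive01 d k.+1.
    case: ifP => [Ak|_]; last by rewrite mulr0 !mulr_ge0 ?exprn_ge0 ?(ltW t0).
    rewrite mulrA ler_wpM2r // -ler_pdivrMr ?exprn_gt0 // -expr_div_n.
    rewrite -(subnKC Ak) exprD ler_piMr ?exprn_ge0 //.
    by rewrite exprn_ile1 // ltW.
  rewrite mul0r addr0 => H; apply: le_trans H _.
  apply: le_trans (ler_wpM2l (exprn_ge0 _ mt0) (tight d)) _.
  by rewrite mulrA ler_wpM2r // mass_ge0.
(* A product of two survival probabilities is small when one of the two sons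
   is entered at most [A] times; [tail] takes care of the others. *)
have split_le eta d k : (forall k, (k <= A)%N -> survive d k <= eta) -> 0 <= eta ->
    survive d k <= eta + tail d k.
  move=> H eta0; rewrite /tail; case: ltnP => Ak; last by rewrite addr0 H.
  by rewrite lerDr.
have [D small_D] := small A e e0.
have grow d : (D <= d)%N -> mass m d <= mass m d.+1.
  move=> Dd; have sd k : (k <= A)%N -> survive d k <= e by exact: small_D.
  have [bS ES] := geosum_sum_sons m01 (sv_bounded d) (survive_j0 d).
  have tail0 : tail d 0 = 0 by [].
  have [bT ET] := geosum_sum_sons m01 (tail_bounded d) tail0.
  rewrite image_ratio_mean // image_mass_mean // -/mu in ES ET.
  have m0' := ltW m0.
  have : (1 - b%:R * e) * geosum m (fun j => first_visit q p
            (fun z : counts b => \sum_(i < b) survive d (z i)) j.+1)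
          + - b%:R * geosum m (fun j => first_visit q p
            (fun z : counts b => \sum_(i < b) tail d (z i)) j.+1) <= mass m d.+1.
    rewrite massS -geosum_lin //; try exact: first_visit_bounded.
    under [in X in X <= _]eq_fun do rewrite -first_visit_lin //.
    apply: ler_geosum => //; try exact: first_visit_bounded.
      by apply: first_visit_bounded; exact: bounded_lin.
    move=> j; apply: ler_first_visit => //; first exact: bounded_lin.
    move=> z.
    have [S0 _ hi] := prod_compl_bounds (index_enum 'I_b) (fun i => survive01 d (z i)).
    rewrite /some_son_survives.
    have : (\sum_(i < b) survive d (z i)) ^+ 2 <=
        b%:R * e * \sum_(i < b) survive d (z i) + b%:R * \sum_(i < b) tail d (z i).
      rewrite expr2 big_distrl /=.
      apply: (@le_trans _ _ (\sum_(i < b) \sum_(i' < b)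
                 (e * survive d (z i') + tail d (z i)))).
        apply: ler_sum => i _; rewrite big_distrr; apply: ler_sum => i' _.
        have := split_le e d (z i) sd (ltW e0).
        have /andP[s0 s1] := survive01 d (z i').
        have /andP[u0 u1] := tail01 d (z i) => h.
        apply: le_trans (ler_wpM2r s0 h) _; rewrite mulrDl lerD2l.
        by rewrite ler_piMr.
      rewrite (eq_bigr (fun i => e * (\sum_(i' < b) survive d (z i'))
                                 + b%:R * tail d (z i))); last first.
        move=> i _; rewrite big_split /= -big_distrr /= sumr_const card_ord.
        by rewrite -[X in _ + X]mulr_natl.
      rewrite big_split /= sumr_const card_ord -big_distrr /= -[X in X + _]mulr_natl.
      by rewrite mulrA.
    lra.
  rewrite ES ET -/(mass m d) => H; apply: le_trans H.
  have a0 := mass_ge0 d m01; have := tail_le d => tl.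
  have T : b%:R * (mu * geosum m (fun k => tail d k.+1)) <= (mu - 1) / 2 * mass m d.
    have -> : (mu - 1) / 2 * mass m d = b%:R * (mu * (e * mass m d)).
      by rewrite -emu; ring.
    by apply: ler_wpM2l; [exact: ltW|apply: ler_wpM2l => //; exact: ltW].
  have T2 : (1 - b%:R * e) * (mu * mass m d) = mu * mass m d - (mu - 1) / 2 * mass m d.
    by rewrite -emu; ring.
  rewrite T2; lra.
have pos d : 0 < mass m d.
  elim: d => [|d IH].
    rewrite /mass (_ : (fun k => survive 0 k.+1) = fun=> 1); last first.
      by apply/funext => k; rewrite survive_d0.
    by rewrite (geosum_cst (ltW m0) m_lt1) mul1r invr_gt0 subr_gt0.
  apply: lt_le_trans (mass_step_ge d m01).
  by rewrite image_ratio_mean // image_mass_mean // mulr_gt0.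
have growD n : mass m D <= mass m (D + n).
  elim: n => [|n IH]; first by rewrite addn0.
  by rewrite addnS; apply: le_trans IH _; apply: grow; rewrite leq_addr.
(* Beyond depth [D] the mass does not decrease, yet it is at most
   [eta / (1 - m)] plus half of itself for deep trees. *)
pose eta := mass m D * (1 - m) / 4.
have eta0 : 0 < eta by rewrite !mulr_gt0 // ?pos // ?subr_gt0 // invr_gt0.
have [D' small_D'] := small A eta eta0.
have sd k : (k <= A)%N -> survive (D + D') k <= eta by apply: small_D'; exact: leq_addl.
have : mass m (D + D') <= 1 * geosum m (fun=> eta)
                          + 1 * geosum m (fun k => tail (D + D') k.+1).
  apply: ler_geosum3 => //; first exact: bounded_cst.
  move=> k; rewrite !mul1r -mulrDr ler_wpM2l ?exprn_ge0 ?(ltW m0) //.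
  by apply: split_le => //; exact: ltW.
rewrite (geosum_cst (ltW m0) m_lt1) !mul1r.
have -> : eta / (1 - m) = mass m D / 4.
  by rewrite /eta; field; rewrite subr_eq0 gt_eqF.
have := tail_le (D + D')%N; have := growD D'; have := pos D.
have := ler_wpM2r (ltW (pos (D + D')%N)) e12; lra.
Qed.

End Subcritical.
End Survival.

(** * Extinction becomes less likely when q increases *)

Section Monotone.
Local Open Scope ring_scope.
Variables (R : realType) (b : nat).
Hypothesis b_gt0 : (0 < b)%N.
Implicit Types (F : counts b -> R) (z : counts b) (p q : R).

Definition decreasing_counts F := forall i z, F (incr i z) <= F z.

Lemma avg_decreasing F z : decreasing_counts F -> avg F z <= F z.
Proof.
move=> dF; rewrite -[X in _ <= X](avg_cst b_gt0 (F z) z) /avg.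
by rewrite ler_wpM2l ?invr_ge0 ?ler0n // ler_sum.
Qed.

Section OneStrength.
Variables (q : R) (q0 : 0 <= q) (q1 : q < 1).

Lemma until_father_decreasing F : is_bounded F -> decreasing_counts F ->
  decreasing_counts (until_father q F).
Proof.
move=> bF dF i z; rewrite -until_father_incr.
apply: ler_until_father => //; last exact: dF.
by case: bF => M FM; exists M => z'; exact: FM.
Qed.

Lemma until_father_le F : is_bounded F -> decreasing_counts F ->
  forall z, until_father q F z <= F z.
Proof.
move=> bF dF z; rewrite -subr_le0.
suff H : forall z, 1 * until_father q F z + -1 * F z <= 0 by have := H z; lra.
have bJ := until_father_bounded b_gt0 q0 q1 bF.
apply: (max_principle b_gt0 q0 q1) => //; first exact: bounded_lin.
move=> {}z; rewrite avg_lin {1}(until_father_step b_gt0 q0 q1 bF) /=.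
have := ler_wpM2l q0 (avg_decreasing z dF); lra.
Qed.

Lemma jumps_decreasing k F : is_bounded F -> decreasing_counts F ->
  decreasing_counts (jumps q k F).
Proof.
move=> bF dF; elim: k => // k IH; rewrite jumpsSE.
by apply: until_father_decreasing => //; exact: jumps_bounded.
Qed.

Lemma jumpsS_le k F z : is_bounded F -> decreasing_counts F ->
  jumps q k.+1 F z <= jumps q k F z.
Proof.
move=> bF dF; rewrite jumpsSE; apply: until_father_le.
  exact: jumps_bounded.
exact: jumps_decreasing.
Qed.

Lemma extinct_sons_decreasing p d : 0 <= p <= 1 ->
  (forall j, extinct p q d [::] ([::] : vertex b) j.+1
          <= extinct p q d [::] ([::] : vertex b) j) ->
  decreasing_counts (extinct_sons p q d [::] ([::] : vertex b)).
Proof.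
move=> p01 dE i z; apply: ler_prod => i' _.
rewrite !(extinct_unvisited _ _ _ [:: i']) // ffunE.
have /andP[-> _] /= :=
  extinct01 b_gt0 p01 q0 q1 d [::] ([::] : vertex b) (z i' + (i' == i)).
by case: (i' == i); rewrite ?addn1 ?addn0.
Qed.

Lemma extinct_decreasing p d j : 0 <= p <= 1 ->
  extinct p q d [::] ([::] : vertex b) j.+1 <= extinct p q d [::] ([::] : vertex b) j.
Proof.
move=> p01; have [p0 p1] := andP p01.
elim: d j => [|d IH] [|j] //.
  by case/andP: (extinct01 b_gt0 p01 q0 q1 d.+1 [::] ([::] : vertex b) 1).
rewrite !extinctS /strength in_nil /first_visit.
set F := extinct_sons _ _ _ _ _.
have F01 z : 0 <= F z <= 1 by exact: extinct_sons01.
have bF := bounded_01 F01.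
have dF : decreasing_counts F by exact: extinct_sons_decreasing.
apply: lerD; apply: ler_wpM2l => //; first by rewrite subr_ge0.
  exact: jumpsS_le.
by apply: ler_avg => z; exact: jumpsS_le.
Qed.

End OneStrength.

(** With a larger [q] more steps to the sons precede the step to the father. *)
Lemma ler_until_father_strength q q' F z : 0 <= q' -> q' <= q -> q < 1 ->
  is_bounded F -> decreasing_counts F -> until_father q F z <= until_father q' F z.
Proof.
move=> q'0 qq q1 bF dF.
have q0 := le_trans q'0 qq; have q'1 := le_lt_trans qq q1.
have bJ := until_father_bounded b_gt0 q0 q1 bF.
have bJ' := until_father_bounded b_gt0 q'0 q'1 bF.
rewrite -subr_le0.
suff H : forall z, 1 * until_father q F z + -1 * until_father q' F z <= 0.
  by have := H z; lra.
apply: (max_principle b_gt0 q0 q1) => //; first exact: bounded_lin.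
move=> {}z; rewrite avg_lin {1}(until_father_step b_gt0 q0 q1 bF).
rewrite {1}(until_father_step b_gt0 q'0 q'1 bF) /=.
have h1 := until_father_le q'0 q'1 bF dF z.
have h2 := avg_decreasing z (until_father_decreasing q'0 q'1 bF dF).
have : (q - q') * (avg (until_father q' F) z - F z) <= 0.
  by rewrite mulr_ge0_le0 ?subr_ge0 // subr_le0; exact: le_trans h1.
lra.
Qed.

Lemma ler_jumps_strength q q' k F z : 0 <= q' -> q' <= q -> q < 1 ->
  is_bounded F -> decreasing_counts F -> jumps q k F z <= jumps q' k F z.
Proof.
move=> q'0 qq q1 bF dF.
have q0 := le_trans q'0 qq; have q'1 := le_lt_trans qq q1.
elim: k z => // k IH z; rewrite !jumpsSE.
have b1 := jumps_bounded b_gt0 q0 q1 k bF.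
have d1 := jumps_decreasing q0 q1 k bF dF.
apply: le_trans (ler_until_father_strength z q'0 qq q1 b1 d1) _.
by apply: ler_until_father => //; exact: jumps_bounded.
Qed.

Lemma ler_extinct_strength p q q' d j : 0 <= p <= 1 -> 0 <= q' -> q' <= q -> q < 1 ->
  extinct p q d [::] ([::] : vertex b) j <= extinct p q' d [::] ([::] : vertex b) j.
Proof.
move=> p01 q'0 qq q1; have [p0 p1] := andP p01.
have q0 := le_trans q'0 qq; have q'1 := le_lt_trans qq q1.
elim: d j => [|d IH] [|j] //.
rewrite !extinctS /strength in_nil /first_visit.
set F := extinct_sons _ q _ _ _; set F' := extinct_sons _ q' _ _ _.
have bF : is_bounded F by apply: bounded_01 => z; exact: extinct_sons01.
have bF' : is_bounded F' by apply: bounded_01 => z; exact: extinct_sons01.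
have dF : decreasing_counts F.
  by apply: extinct_sons_decreasing => // j'; exact: extinct_decreasing.
have FF' z : F z <= F' z.
  apply: ler_prod => i _; rewrite !(extinct_unvisited _ _ _ [:: i]) // IH andbT.
  by case/andP: (extinct01 b_gt0 p01 q0 q1 d [::] ([::] : vertex b) (z i)).
have JJ k z : jumps q k F z <= jumps q' k F' z.
  apply: le_trans (ler_jumps_strength k z q'0 qq q1 bF dF) _.
  exact: ler_jumps.
apply: lerD; apply: ler_wpM2l => //; first by rewrite subr_ge0.
exact: ler_avg.
Qed.

(** For [m >= 1] the walk is compared with the one of mean [3 / 4], whose
    [lambda1] is at least [9 / 16 > 1 / b]. *)
Lemma survive_transient p q : (1 < b)%N -> 0 <= p < 1 -> 0 < q -> q < 1 ->
  b%:R^-1 < lambda1 b p q ->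
  exists k e, 0 < e /\ forall d, e <= survive b p q d k.
Proof.
move=> b1 p01 q0 q1 lam.
have bR0 : 0 < b%:R :> R by rewrite ltr0n.
have p01' : 0 <= p <= 1 by case/andP: p01 => -> /ltW.
have [m1|m1] := ltP (son_mean b q) 1.
  apply: survive_supercritical => //.
  by rewrite -ltr_pdivrMl // mulr1.
pose q' : R := 3 * b%:R / (3 * b%:R + 4).
have den : 0 < 3 * b%:R + 4 :> R by lra.
have q'0 : 0 < q' by rewrite divr_gt0 // mulr_gt0.
have q'1 : q' < 1 by rewrite ltr_pdivrMr //; lra.
have mE : son_mean b q' = 3 / 4.
  rewrite /son_mean /q'; field; rewrite !gt_eqF //; lra.
have q'q : q' <= q.
  move: m1; rewrite /son_mean ler_pdivlMr ?mulr_gt0 ?subr_gt0 // mul1r => m1.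
  rewrite ler_pdivrMr //; nra.
have [k [e [e0 H]]] : exists k e, 0 < e /\ forall d, e <= survive b p q' d k.
  apply: survive_supercritical => //; first by rewrite mE; lra.
  rewrite /lambda1 -/(son_mean b q') mE.
  have b2 : 2 <= b%:R :> R by rewrite ler_nat.
  rewrite (_ : b%:R * _ = b%:R * (9 / 16 + 3 / 16 * p) + p / 4); last first.
    by field; rewrite gt_eqF.
  case/andP: p01 => p0 _; nra.
exists k, e; split=> // d; apply: le_trans (H d) _; rewrite lerD2l lerN2.
by apply: ler_extinct_strength => //; exact: ltW.
Qed.

End Monotone.

(** * The law of the walk up to a fixed time *)

Lemma move_inj b (v : vertex b) : injective (move v).
Proof.
by move=> [i|] [i'|] //= [] => [->//|/(congr1 size)|/(congr1 size)];
   rewrite size_behead /=; lia.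
Qed.

Section PathLaw.
Local Open Scope classical_set_scope.
Local Open Scope ring_scope.
Variables (R : realType) (d : measure_display) (Omega : measurableType d).
Variables (P : probability Omega R) (b : nat).
Hypothesis b_gt0 : (0 < b)%N.
Variables (p q : R).
Hypotheses (p01 : 0 <= p <= 1) (q0 : 0 <= q) (q1 : q < 1).
Variable X : nat -> Omega -> vertex b.
Hypothesis hX : cookie_random_walk P [:: p] q X.
Implicit Types (v : vertex b) (x : nat -> vertex b) (h : seq (vertex b)).
Implicit Types (S T : set Omega) (A : seq (vertex b) -> bool) (k n : nat).

Definition Pr S : R := fine (P S).

Lemma PrE S : measurable S -> P S = (Pr S)%:E.
Proof. by move=> mS; rewrite /Pr fineK // fin_num_measure. Qed.

Lemma Pr_ge0 S : 0 <= Pr S.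
Proof. exact: fine_ge0. Qed.

Lemma Pr_le S T : measurable S -> measurable T -> S `<=` T -> Pr S <= Pr T.
Proof.
move=> mS mT ST; rewrite -lee_fin -!PrE //.
by apply: le_measure; rewrite ?inE.
Qed.

Lemma Pr_setT : Pr setT = 1.
Proof. by rewrite /Pr probability_setT. Qed.

Lemma Pr_split S T : measurable S -> measurable T ->
  Pr S = Pr (S `&` T) + Pr (S `&` ~` T).
Proof.
move=> mS mT; have mT' := measurableC mT.
apply: EFin_inj; rewrite EFinD -!PrE; try exact: measurableI; try by [].
rewrite -measureU; try exact: measurableI; first by rewrite -setIUr setUv setIT.
by rewrite setIACA setICr setI0.
Qed.

Lemma sum_Pr_le (I : eqType) (r : seq I) (F : I -> set Omega) S : uniq r ->
  measurable S -> (forall i, measurable (F i)) -> (forall i, F i `<=` S) ->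
  (forall i j, i != j -> F i `&` F j = set0) -> \sum_(i <- r) Pr (F i) <= Pr S.
Proof.
move=> ur mS mF FS Fdisj.
suff H : forall r S, uniq r -> measurable S -> (forall i, i \in r -> F i `<=` S) ->
    \sum_(i <- r) Pr (F i) <= Pr S by apply: H => // i _.
elim=> [|i {}r IH] {mS FS ur}S; first by rewrite big_nil => *; exact: Pr_ge0.
move=> /= /andP[ir ur] mS FS; rewrite big_cons (Pr_split mS (mF i)).
have mC := measurableC (mF i).
apply: lerD; first apply: Pr_le => //; first exact: measurableI.
  by move=> w Fw; split=> //; apply: FS (mem_head _ _) _ Fw.
apply: IH => //; first exact: measurableI.
move=> j jr w Fw; split; first by apply: FS Fw; rewrite inE jr orbT.
move=> Fiw; have : (F i `&` F j) w by [].
by rewrite Fdisj //; apply: contraNneq ir => ->.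
Qed.

(** The trajectory strictly before time [n], most recent position first. *)
Fixpoint prior x n : seq (vertex b) :=
  if n is n'.+1 then x n' :: prior x n' else [::].

Lemma prior_eq x x' n : (forall k, (k < n)%N -> x k = x' k) <-> prior x n = prior x' n.
Proof.
elim: n => [|n IH] //=; split=> [xx'|[xn /IH xx'] k].
  by rewrite xx' //; congr (_ :: _); apply/IH => k kn; apply: xx'; exact: ltnW.
by rewrite ltnS leq_eqVlt => /orP[/eqP ->|/xx'].
Qed.

Lemma visits_prior x n : visits x n = (count_mem (x n) (prior x n)).+1.
Proof.
rewrite -[RHS]/(1 + _)%N /visits -sum1dep_card big_mkcond big_ord_recr /= eqxx.
rewrite addnC; congr (_ + _)%N; move: (x n) => v.
elim: n => [|n IH]; first by rewrite big_ord0.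
by rewrite big_ord_recr IH /= addnC; case: eqP.
Qed.

Lemma strength_visits x n :
  cookie_strength [:: p] q (visits x n) = strength p q (prior x n) (x n).
Proof.
rewrite /cookie_strength visits_prior /strength /=.
by case: count (has_count (pred1 (x n)) (prior x n)) => [|c]; rewrite has_pred1 => -> //=;
   rewrite nth_nil.
Qed.

Lemma measurable_prior_eq n h : measurable [set w | prior (X^~ w) n = h].
Proof.
elim: n h => [|n IH] [|v h] /=.
- by rewrite (_ : [set _ | _] = setT) //; apply/seteqP; split.
- by rewrite (_ : [set _ | _] = set0) //; apply/seteqP; split.
- by rewrite (_ : [set _ | _] = set0) //; apply/seteqP; split.
rewrite (_ : [set _ | _] = (X n @^-1` [set v]) `&` [set w | prior (X^~ w) n = h]).
  by apply: measurableI => //; exact: walk_measurable hX _ _.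
by apply/seteqP; split=> w /= [-> ->].
Qed.

Lemma measurable_path A n : measurable [set w | A (prior (X^~ w) n)].
Proof.
rewrite (_ : [set _ | _] = \bigcup_h [set w | prior (X^~ w) n = h /\ A h]).
  apply: countable_bigcupT_measurable => [|h]; first exact: countableP.
  case Ah : (A h).
    rewrite (_ : [set _ | _] = [set w | prior (X^~ w) n = h]).
      exact: measurable_prior_eq.
    by apply/seteqP; split=> w /=; [case|].
  by rewrite (_ : [set _ | _] = set0) //; apply/seteqP; split=> w //= [].
apply/seteqP; split=> w /=; first by exists (prior (X^~ w) n).
by case=> h _ [->].
Qed.

Lemma historyE n x : history X n x = [set w | prior (X^~ w) n.+1 == prior x n.+1].
Proof.
apply/seteqP; split=> w.
  by move=> H; apply/eqP/prior_eq => k; rewrite ltnS; exact: H.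
by move=> /eqP/(@prior_eq (X^~ w) x n.+1) H k kn; apply: H; rewrite ltnS.
Qed.

Lemma measurable_history n x : measurable (history X n x).
Proof. by rewrite historyE; exact: (measurable_path (fun h => h == prior x n.+1) n.+1). Qed.

Definition extend x n v : nat -> vertex b := fun k => if (k <= n)%N then x k else v.

Lemma prior_extend x n v : prior (extend x n v) n.+1 = prior x n.+1.
Proof. by apply/prior_eq => k; rewrite ltnS /extend => ->. Qed.

Lemma history_extend x n v :
  history X n.+1 (extend x n v) = history X n x `&` X n.+1 @^-1` [set v].
Proof.
apply/seteqP; split=> w /=.
  move=> H; split=> [k kn|]; first by rewrite H ?leqW // /extend kn.
  by rewrite /= H // /extend ltnn.
move=> [H Xv] k; rewrite leq_eqVlt => /orP[/eqP ->|kn]; first by rewrite /extend ltnn.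
by rewrite H // /extend; move: kn; rewrite ltnS => ->.
Qed.

Lemma Pr_history_extend x n (o : option 'I_b) :
  Pr (history X n.+1 (extend x n (move (x n) o)))
  = Pr (history X n x) * move_prob p q (prior x n) (x n) o.
Proof.
rewrite history_extend setIC.
have mh := measurable_history n x.
have mX v : measurable (X n.+1 @^-1` [set v]) by exact: walk_measurable hX _ _.
have [h0|h0] := eqVneq (P (history X n x)) 0%E.
  have Ph0 : Pr (history X n x) = 0 by rewrite /Pr h0.
  rewrite Ph0 mul0r; apply/eqP; rewrite eq_le Pr_ge0 andbT -Ph0.
  by apply: Pr_le; [exact: measurableI|exact: mh|exact: subIsetr].
have Prh : Pr (history X n x) != 0.
  by apply: contraNneq h0 => e; rewrite PrE // e.
rewrite mulrC; apply: (canRL (divfK Prh)).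
rewrite -/(cond_prob P _ _); case: o => [i|] /=.
  by rewrite (walk_son hX) // strength_visits.
by rewrite (walk_father hX) // strength_visits.
Qed.

(** Expectation over the next [n] steps of a walker at [v] with past [h]; [f] is
    applied to the whole trajectory, its last position included. *)
Fixpoint expect n (f : seq (vertex b) -> R) v h : R :=
  if n is n'.+1 then \sum_o move_prob p q h v o * expect n' f (move v o) (v :: h)
  else f (v :: h).

Lemma move_prob_ge0 h v o : 0 <= move_prob p q h v o.
Proof.
have /andP[s0 s1] := strength01 p01 q0 q1 h v.
by case: o => [i|] /=; rewrite ?subr_ge0 // divr_ge0.
Qed.

Lemma sum_move_prob h v : \sum_o move_prob p q h v o = 1.
Proof.
rewrite big_option /= sumr_const card_ord -[X in _ + X]mulr_natr divfK ?subrK //.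
by rewrite pnatr_eq0 -lt0n.
Qed.

Lemma ler_expect n f g v h : (forall h, f h <= g h) -> expect n f v h <= expect n g v h.
Proof.
move=> fg; elim: n v h => [|n IH] v h /=; first exact: fg.
by apply: ler_sum => o _; rewrite ler_wpM2l ?move_prob_ge0.
Qed.

Lemma expect_lin n a c f v h :
  expect n (fun h => a * f h + c) v h = a * expect n f v h + c.
Proof.
elim: n v h => [|n IH] v h //=; under eq_bigr do rewrite IH mulrDr mulrCA.
by rewrite big_split /= -big_distrr -big_distrl /= sum_move_prob mul1r.
Qed.

Lemma expect_cst n c v h : expect n (fun=> c) v h = c.
Proof.
elim: n v h => //= n IH v h; under eq_bigr do rewrite IH.
by rewrite -big_distrl /= sum_move_prob mul1r.
Qed.

(** As a lower bound this follows from the disjointness of the possible next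
    steps alone, without discarding the null event of an impossible step. *)
Lemma path_law_ge k x n A :
  Pr (history X n x) * expect k (fun h => (A h)%:R) (x n) (prior x n)
  <= Pr (history X n x `&` [set w | A (prior (X^~ w) (n + k).+1)]).
Proof.
have mh n' x' := measurable_history n' x'.
elim: k x n => [|k IH] x n.
  rewrite addn0 -[expect _ _ _ _]/((A (prior x n.+1))%:R : R).
  case Ax : (A _); last by rewrite mulr0 Pr_ge0.
  rewrite mulr1; apply: Pr_le => //.
    exact: (measurableI _ _ (mh n x) (measurable_path A n.+1)).
  move=> w hw; split=> //; move: hw; rewrite historyE => /eqP E.
  by rewrite /mkset E.
rewrite addnS -addSn [expect _ _ _ _]/= big_distrr /=.
set B := [set w | _]; have mB : measurable B by exact: (measurable_path A (n.+1 + k).+1).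
pose F o := history X n.+1 (extend x n (move (x n) o)) `&` B.
apply: (@le_trans _ _ (\sum_o Pr (F o))).
  apply: ler_sum => o _; rewrite mulrA -Pr_history_extend.
  have := IH (extend x n (move (x n) o)) n.+1.
  rewrite prior_extend (_ : extend x n _ n.+1 = move (x n) o) //.
  by rewrite /extend ltnn.
apply: sum_Pr_le; rewrite ?index_enum_uniq //; try by move=> *; exact: measurableI.
  by move=> o; rewrite /F history_extend; apply: setSI; exact: subIsetl.
move=> o o' oo'; rewrite /F !history_extend.
apply/seteqP; split=> w //= [[[_ Xo] _] [[_ Xo'] _]].
by have := @move_inj _ _ _ _ (etrans (esym Xo) Xo') => /eqP; rewrite (negPf oo').
Qed.

(** The lower bounds for [A] and for its complement add up to [1], so that both
    are equalities. *)
Lemma path_law k A :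
  Pr [set w | A (prior (X^~ w) k.+1)] = expect k (fun h => (A h)%:R) [::] [::].
Proof.
have start : Pr (history X 0 (fun=> [::])) = 1.
  rewrite /Pr (_ : history _ _ _ = X 0%N @^-1` [set root_vertex b]).
    by rewrite (walk_start hX).
  apply/seteqP; split=> w /=; first by move=> /(_ 0%N (leqnn _)).
  by move=> H j; rewrite leqn0 => /eqP ->.
have lower A' : expect k (fun h => (A' h)%:R) [::] [::]
             <= Pr [set w | A' (prior (X^~ w) k.+1)].
  have := path_law_ge k (fun=> [::]) 0 A'; rewrite start mul1r => H.
  have mA := measurable_path A' k.+1; have mh := measurable_history 0 (fun=> [::]).
  by apply: le_trans H _; apply: Pr_le; [exact: measurableI|exact: mA|exact: subIsetr].
apply/eqP; rewrite eq_le lower andbT.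
have := lower (fun h => ~~ A h).
rewrite (_ : (fun h => (~~ A h)%:R) = fun h => -1 * (A h)%:R + 1); last first.
  by apply/funext => h; case: (A h); rewrite ?mulr1 ?mulr0 ?addNr ?add0r.
rewrite expect_lin.
have := Pr_split measurableT (measurable_path A k.+1); rewrite Pr_setT !setTI.
rewrite (_ : ~` [set w | A _] = [set w | ~~ A (prior (X^~ w) k.+1)]); first by lra.
by apply/seteqP; split=> w /=; [move/negP|move/negP].
Qed.

End PathLaw.

(** * The walk plays the game *)

Section GameOnPaths.
Local Open Scope ring_scope.
Variables (R : realType) (b : nat).
Hypothesis b_gt0 : (0 < b)%N.
Variables (p q : R).
Hypotheses (p01 : 0 <= p <= 1) (q0 : 0 <= q) (q1 : q < 1).
Implicit Types (v : vertex b) (h : seq (vertex b)) (k n L N : nat).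

Fixpoint root_loops h : nat :=
  if h is x :: h' then
    if h' is y :: _ then ((x == [::]) && (y == [::]) + root_loops h')%N else 0%N
  else 0%N.

Definition reaches L h := has (fun v => (L <= size v)%N) h.

Definition father_closed h := forall v, v \in h -> father v \in h.

Lemma father_closed_move v h o :
  father_closed (v :: h) -> father_closed (move v o :: v :: h).
Proof.
move=> cl u; rewrite inE => /orP[/eqP ->|uh]; last by rewrite inE cl ?orbT.
case: o => [i|] /=; rewrite inE; apply/orP; right; rewrite ?mem_head //.
by rewrite cl // cl // mem_head.
Qed.

Lemma root_loops_move v h o :
  root_loops (move v o :: v :: h) = (root_loop v o + root_loops (v :: h))%N.
Proof.
congr (nat_of_bool _ + _)%N; rewrite /root_loop.
by case: v o => [|j v] [i|] //=; rewrite andbF.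
Qed.

Lemma win_too_deep L k x h : (0 < k)%N -> (L <= size x)%N -> win p q L k x h = 0.
Proof.
move=> k0 Lx; rewrite /win (eqP Lx).
rewrite (@eq_from_below _ _ _ _ _ _ _ _ _ (fun j => \sum_(o < 0) (0 : R) * 0)) //; last first.
  by move=> j; rewrite big_ord0.
rewrite from_below_sum // => [|o]; first by rewrite big_ord0.
exact: bounded_cst.
Qed.

Local Notation expect := (expect p q).

Lemma expect_sure n (A : seq (vertex b) -> bool) v h :
  (forall v' h' o, A (v' :: h') -> A (move v' o :: v' :: h')) -> A (v :: h) ->
  expect n (fun h => (A h)%:R) v h = 1.
Proof.
move=> stepA; elim: n v h => [|n IH] v h Ah; first by rewrite /= Ah.
rewrite /= -[RHS](sum_move_prob b_gt0 p q h v); apply: eq_bigr => o _.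
by rewrite IH ?mulr1 //; exact: stepA.
Qed.

(** By induction on the time from [win_harmonic]; a state at level [L] has the
    value [0]. *)
Lemma win_le_expect n L k N v h : father_closed (v :: h) -> ~~ reaches L (v :: h) ->
  (root_loops (v :: h) + k = N)%N ->
  win p q L k v h <=
  expect n (fun h' => ((N <= root_loops h')%N || ~~ reaches L h')%:R) v h.
Proof.
elim: n k v h => [|n IH] k v h cl nr kN.
  by rewrite /= -/(reaches L (v :: h)) nr orbT; case/andP: (win01 b_gt0 p01 q0 q1 L k v h).
have [k0|k0] := posnP k.
  have NE : N = root_loops (v :: h) by rewrite -kN k0 addn0.
  pose A h' := (N <= root_loops h')%N.
  rewrite k0; apply: (@le_trans _ _ 1).
    by case/andP: (win01 b_gt0 p01 q0 q1 L 0 v h).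
  rewrite -[X in X <= _](@expect_sure n.+1 A v h) ?/A ?NE //; last first.
    move=> v' h' o H; apply: leq_trans H _; rewrite root_loops_move; exact: leq_addl.
  apply: ler_expect => // h'; cbv beta; rewrite ler_nat.
  by case: (root_loops _ <= _)%N.
have vL : (size v < L)%N by move: nr; rewrite /reaches /= negb_or -ltnNge => /andP[].
rewrite win_harmonic //; last by apply: cl; exact: mem_head.
apply: ler_sum => o _; apply: ler_wpM2l; first exact: move_prob_ge0.
have [deep|] := leqP L (size (move v o)).
  have -> : root_loop v o = false.
    rewrite /root_loop; case: o deep => [i _|/= ]; first by rewrite andbF.
    by rewrite size_behead leqNgt (leq_ltn_trans (leq_pred _) vL).
  rewrite subn0 win_too_deep //.
  apply: (@le_trans _ _ (expect n (fun=> 0) (move v o) (v :: h))).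
    by rewrite expect_cst.
  by apply: ler_expect => // h'; rewrite ler0n.
move=> shallow; apply: IH; first exact: father_closed_move.
  by rewrite /reaches /= negb_or -ltnNge shallow.
rewrite root_loops_move -kN; case: root_loop; lia.
Qed.

(** Level [L] cannot be reached within [n] steps, so completing the loops by
    then wins the game. *)
Lemma expect_le_win n L k N v h : father_closed (v :: h) -> (n + size v < L)%N ->
  (root_loops (v :: h) + k = N)%N -> (0 < k)%N || (v == [::]) ->
  expect n (fun h' => (N <= root_loops h')%N%:R) v h <= win p q L k v h.
Proof.
elim: n k v h => [|n IH] k v h cl nL kN kv.
  have [k0|k0] := posnP k.
    move: kv; rewrite k0 /= => /eqP v0; rewrite v0 win_root0.
    by case: (_ <= _)%N; rewrite ?ler01.
  rewrite [expect _ _ _ _]/= (_ : (_ <= _)%N = false).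
    by case/andP: (win01 b_gt0 p01 q0 q1 L k v h).
  apply/negbTE; rewrite -ltnNge -kN; case: k k0 {kv kN} => // k _.
  by rewrite addnS ltnS leq_addr.
have [k0|k0] := posnP k.
  move: kv; rewrite k0 /= => /eqP v0; rewrite v0 win_root0.
  rewrite -[X in _ <= X](@expect_cst _ _ b_gt0 p q n.+1 1 [::] h) -/(expect n.+1 _ _ _).
  by apply: ler_expect => // h'; case: (_ <= _)%N; rewrite ?ler01.
rewrite win_harmonic //; last 2 first.
- by move: nL; lia.
- by apply: cl; exact: mem_head.
apply: ler_sum => o _; apply: ler_wpM2l; first exact: move_prob_ge0.
apply: IH; first exact: father_closed_move.
- by case: o => [i|] /=; rewrite ?size_behead; move: nL; lia.
- rewrite root_loops_move -kN; case: root_loop; lia.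
rewrite /root_loop; case: eqP => [->|_]; case: o => [i|] //=; rewrite ?subn0 ?k0 ?orbT //.
Qed.

End GameOnPaths.

(** * Steps that are possible infinitely often are taken infinitely often *)

Section Recurrence.
Local Open Scope classical_set_scope.
Local Open Scope ring_scope.
Variables (R : realType) (d : measure_display) (Omega : measurableType d).
Variables (P : probability Omega R) (b : nat).
Hypothesis b_gt1 : (1 < b)%N.
Variables (p q : R).
Hypotheses (p01 : 0 <= p < 1) (q0 : 0 < q) (q1 : q < 1).
Variable X : nat -> Omega -> vertex b.
Hypothesis hX : cookie_random_walk P [:: p] q X.
Implicit Types (v y : vertex b) (h : seq (vertex b)) (w : Omega) (k n L N : nat).

Let b_gt0 : (0 < b)%N. Proof. exact: ltnW. Qed.
Let q0' : 0 <= q. Proof. exact: ltW. Qed.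
Let p01' : 0 <= p <= 1. Proof. by case/andP: p01 => -> /ltW. Qed.
Let bR_gt1 : 1 < b%:R :> R. Proof. by rewrite ltr1n. Qed.

Definition eventually (B : nat -> set Omega) : set Omega :=
  \bigcup_n0 \bigcap_n B (n0 + n)%N.

Lemma measurable_eventually (B : nat -> set Omega) :
  (forall n, measurable (B n)) -> measurable (eventually B).
Proof.
move=> mB; apply: bigcupT_measurable => n0; apply: bigcapT_measurable => n; exact: mB.
Qed.

Lemma Pr_eventually (B : nat -> set Omega) e : (forall n, measurable (B n)) ->
  (forall n, Pr P (B n) <= e) -> Pr P (eventually B) <= e.
Proof.
move=> mB Be; pose F n0 := \bigcap_n B (n0 + n)%N.
have mF n : measurable (F n) by apply: bigcapT_measurable => k; exact: mB.
have FB n : F n `<=` B n by move=> w /(_ 0%N I); rewrite addn0.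
have ndF : nondecreasing_seq F.
  move=> m n mn; rewrite subsetEset => w Fw k _.
  by rewrite -(subnKC mn) -addnA; exact: Fw.
rewrite -lee_fin -PrE; last exact: measurable_eventually.
have cF := nondecreasing_cvg_mu (mu := P) mF (bigcupT_measurable F mF) ndF.
rewrite /eventually -/F -(cvg_lim _ cF) //; apply: lime_le.
  by apply/cvg_ex; eexists; exact: cF.
apply: nearW => n /=; rewrite PrE // lee_fin; apply: le_trans (Be n).
exact: Pr_le.
Qed.

Lemma probability1 (S : set Omega) : measurable S -> P.-negligible (~` S) -> P S = 1%E.
Proof.
move=> mS nS; have : P (~` S) = 0%E by apply: measure_negligible => //; exact: measurableC.
by rewrite probability_setC // PrE // => /eqP; rewrite -EFinB eqe subr_eq0 => /eqP <-.
Qed.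

Lemma negligible_eventually (S : set Omega) :
  (forall e, 0 < e -> exists B : nat -> set Omega,
     [/\ forall n, measurable (B n), forall n, Pr P (B n) <= e & S `<=` eventually B]) ->
  P.-negligible S.
Proof.
move=> H.
have /choice[T HT] : forall k, exists T : set Omega,
    [/\ measurable T, Pr P T <= k.+1%:R^-1 & S `<=` T].
  move=> k; have [|B [mB Be SB]] := H k.+1%:R^-1; first by rewrite invr_gt0 ltr0n.
  by exists (eventually B); split=> //; [exact: measurable_eventually|exact: Pr_eventually].
have mT : measurable (\bigcap_k T k) by apply: bigcapT_measurable => k; have [] := HT k.
exists (\bigcap_k T k); split=> //; last by move=> w Sw k _; have [_ _] := HT k; exact.
rewrite PrE //; congr (_%:E); apply/eqP; rewrite eq_le Pr_ge0 andbT.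
apply/ler_addgt0Pr => e e0; rewrite add0r.
have := archi_boundP (ltW (divr_gt0 ltr01 e0)); set n := Num.bound _ => ne.
have [mTn Tn _] := HT n.
apply: (@le_trans _ _ (Pr P (T n))); first by apply: Pr_le => // w; exact.
apply: le_trans Tn _; rewrite invf_ple ?posrE ?ltr0n // -div1r.
by apply: ltW; apply: lt_trans ne _; rewrite ltr_nat.
Qed.

Section OneStep.
Variables (y : vertex b) (o : option 'I_b).

Let c : R := if o is Some _ then q / b%:R else 1 - q.
Let rho : R := 1 - c.

Let rho01 : 0 < rho < 1.
Proof.
have bR0 : 0 < b%:R :> R by rewrite ltr0n.
rewrite /rho /c; case: o => [i|]; last by rewrite subKr q0.
rewrite subr_gt0 ltrBlDr ltrDl divr_gt0 // andbT ltr_pdivrMr // mul1r.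
exact: lt_trans bR_gt1.
Qed.

(** Stake of a gambler who, from time [N] on, bets at each visit to [y] other
    than the first one that the step [o] is not taken, at fair odds. *)
Fixpoint stake N h : R :=
  if h is v :: h' then
    if h' is x :: h'' then
      stake N h' *
      (if (N <= size h'')%N && (x == y) then
         if v == move y o then 0 else if x \in h'' then rho^-1 else 1
       else 1)
    else 1
  else 1.

Lemma stake_ge0 N h : 0 <= stake N h.
Proof.
elim: h => //= v [|x h] IH //; rewrite mulr_ge0 //.
have /andP[r0 _] := rho01.
case: ifP => // _; case: ifP => // _; case: ifP => // _.
by rewrite invr_ge0 ltW.
Qed.

Lemma stake_cons N v x h : stake N (v :: x :: h) = stake N (x :: h) *
  (if (N <= size h)%N && (x == y) then
     if v == move y o then 0 else if x \in h then rho^-1 else 1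
   else 1).
Proof. by []. Qed.

Lemma expect_stake N n v h : expect p q n (stake N) v h <= stake N (v :: h).
Proof.
elim: n v h => [//|n IH] v h.
apply: (@le_trans _ _ (\sum_o' move_prob p q h v o' * stake N (move v o' :: v :: h))).
  by apply: ler_sum => o' _; rewrite ler_wpM2l ?move_prob_ge0 //; exact: IH.
rewrite -[X in _ <= X]mulr1 -[X in _ <= _ * X](sum_move_prob b_gt0 p q h v).
under eq_bigr do rewrite stake_cons mulrCA.
rewrite -big_distrr; apply: ler_wpM2l; first exact: stake_ge0.
rewrite [X in X <= _]/=.
case: (boolP ((N <= size h)%N && (v == y))) => [/andP[_ /eqP ->]|_]; last first.
  by apply: ler_sum => o' _; rewrite mulr1.
case yh: (y \in h); last first.
  by apply: ler_sum => o' _; apply: ler_piMr; rewrite ?move_prob_ge0 //; case: ifP.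
have /andP[r0 _] := rho01.
rewrite sum_move_prob // (bigD1 o) //= eqxx mulr0 add0r.
rewrite (eq_bigr (fun o' => move_prob p q h y o' * rho^-1)); last first.
  by move=> o' oo'; rewrite (inj_eq (@move_inj b y)) (negPf oo').
rewrite -big_distrl /= ler_pdivrMr // mul1r.
have := sum_move_prob b_gt0 p q h y; rewrite (bigD1 o) //= => E.
rewrite /rho /c; move: E; rewrite /move_prob /strength yh.
by case: (o) => [i|] /(canRL (addKr _)) ->; rewrite addrC.
Qed.

Definition visited_io w v := forall N, exists2 n, (N <= n)%N & X n w = v.

Definition step_io w :=
  forall N, exists n, [/\ (N <= n)%N, X n w = y & X n.+1 w = move y o].

Lemma stake_grows w N : visited_io w y ->
  (forall n, (N <= n)%N -> X n w = y -> X n.+1 w <> move y o) ->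
  forall m, exists n0, forall n, (n0 <= n)%N -> rho^-1 ^+ m <= stake N (prior (X^~ w) n.+1).
Proof.
move=> vy nostep; have /andP[r0 r1] := rho01.
have ri1 : 1 <= rho^-1 by rewrite invf_ge1 // ltW.
pose g n := stake N (prior (X^~ w) n.+1).
have size_prior n : size (prior (X^~ w) n) = n by elim: n => //= n ->.
have gS n : g n.+1 = g n * (if (N <= n)%N && (X n w == y) then
    if X n w \in prior (X^~ w) n then rho^-1 else 1 else 1).
  rewrite /g [in LHS]/= size_prior; congr (_ * _).
  case: (boolP ((N <= n)%N && (X n w == y))) => // /andP[Nn /eqP yn].
  by case: eqP => // /(nostep n Nn yn).
have g_ge0 n : 0 <= g n by exact: stake_ge0.
have gmono m n : (m <= n)%N -> g m <= g n.
  move=> /subnKC <-; elim: (n - m)%N => [|k IH]; first by rewrite addn0.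
  rewrite addnS gS; apply: le_trans IH _; apply: ler_peMr => //.
  by case: ifP => // _; case: ifP.
elim=> [|m [n0 IH]].
  exists 0%N => n _; rewrite expr0; apply: le_trans (gmono 0%N n (leq0n n)).
  by rewrite /g /=.
have [t1 Nt1 yt1] := vy N.
have [t tn0 yt] := vy (maxn n0 t1.+1).
move: tn0; rewrite geq_max => /andP[n0t t1t].
exists t.+1 => n tn; apply: le_trans (gmono _ _ tn).
rewrite gS (leq_trans Nt1 (ltnW t1t)) yt eqxx /=.
have -> : y \in prior (X^~ w) t.
  rewrite -yt1; elim: t t1t {yt n0t tn} => // t IHt.
  by rewrite ltnS leq_eqVlt /= inE => /orP[/eqP ->|/IHt ->]; rewrite ?eqxx ?orbT.
by rewrite exprSr ler_wpM2r ?IH // invr_ge0 ltW.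
Qed.

(** While the step [o] is not taken, the stake grows without bound along the
    visits to [y]; its expectation stays at most [1]. *)
Lemma ae_step : \forall w \ae P, visited_io w y -> step_io w.
Proof.
pose bad N := [set w | visited_io w y /\
  forall n, (N <= n)%N -> X n w = y -> X n.+1 w <> move y o].
apply: (@negligibleS _ _ _ P (\bigcup_N bad N)).
  move=> w /= /not_implyP[vy /existsNP[N HN]]; exists N => //; split=> // n Nn yn yn1.
  by apply: HN; exists n.
apply: negligible_bigcup => N; apply: negligible_eventually => e e0.
have /andP[r0 r1] := rho01.
have [m] := geometric_small (ltW r0) r1 1 e0; rewrite mulr1 => rm.
pose A h := rho^-1 ^+ m <= stake N h.
exists (fun n => [set w | A (prior (X^~ w) n.+1)]); split=> [n|n|w [vy nostep]].
- exact: (measurable_path hX A).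
- rewrite (path_law b_gt0 hX n A).
  apply: (@le_trans _ _ (expect p q n (fun h => rho ^+ m * stake N h + 0) [::] [::])).
    apply: ler_expect => // h; rewrite addr0 /A exprVn.
    case: (leP (rho ^- m) (stake N h)) => [H|_]; last first.
      by rewrite mulr_ge0 ?stake_ge0 // exprn_ge0 // ltW.
    by rewrite -ler_pdivrMl ?exprn_gt0 // mulr1.
  rewrite expect_lin // addr0; apply: le_trans rm.
  rewrite ler_piMr ?exprn_ge0 ?(ltW r0) //; exact: expect_stake.
- have [n0 H] := stake_grows vy nostep m; exists n0 => // n _.
  by apply: H; rewrite leq_addr.
Qed.

End OneStep.

Lemma ae_all_steps : \forall w \ae P, forall y o, visited_io w y -> step_io y o w.
Proof.
pose Q (n : nat) w := if unpickle n is Some yo then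
  visited_io w (yo.1 : vertex b) -> step_io yo.1 (yo.2 : option 'I_b) w else True.
have H : \forall w \ae P, forall n, Q n w.
  apply: ae_foralln => n; rewrite /Q; case: unpickle => [[y o]|]; first exact: ae_step.
  exact: aeW.
apply: filterS H => w Hw y o; have := Hw (pickle (y : seq 'I_b, o)).
by rewrite /Q pickleK.
Qed.

(** Each vertex can be joined to any other by steps that recur almost surely. *)
Lemma visited_io_all w : (forall y o, visited_io w y -> step_io y o w) ->
  (exists y, visited_io w y) -> forall v, visited_io w v.
Proof.
move=> steps [y vy].
have go x o : visited_io w x -> visited_io w (move x o).
  by move=> /(steps x o) H N; have [n [Nn _ Xn]] := H N; exists n.+1 => //; exact: leqW.
have root : visited_io w [::] by elim: y vy => // i y IH /(go _ None)/IH.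
by elim=> // i v IH; exact: (go v (Some i)).
Qed.

Lemma visited_io_shallow w L : (forall n, (size (X n w) <= L)%N) ->
  exists y, visited_io w y.
Proof.
move=> XL; pose s : seq (vertex b) := [seq val u | u <- enum {: L.-bseq 'I_b}].
have Xs n : X n w \in s.
  by rewrite -[X n w]/(val (Bseq (XL n))); apply: map_f; rewrite mem_enum.
suff H : forall (s : seq (vertex b)) N, (forall n, (N <= n)%N -> X n w \in s) ->
    exists y, visited_io w y by apply: (H s 0%N).
elim=> [|y {Xs}s' IH] N Hs; first by have := Hs N (leqnn N).
have [vy|] := pselect (visited_io w y); first by exists y.
move=> /existsNP[N' HN']; apply: (IH (maxn N N')) => n.
rewrite geq_max => /andP[Nn N'n]; have := Hs n Nn; rewrite inE => /orP[/eqP e|//].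
by case: HN'; exists n.
Qed.

Definition recurrent_set : set Omega :=
  [set w | forall (v : vertex b) N, exists2 n, (N <= n)%N & X n w = v].

Lemma measurable_recurrent_set : measurable recurrent_set.
Proof.
have -> : recurrent_set =
    ~` (\bigcup_(v in [set: vertex b]) ~` (\bigcap_N \bigcup_n (X (N + n)%N @^-1` [set v]))).
  apply/seteqP; split=> w.
    move=> Rw [v _]; apply => N _; have [n Nn Xn] := Rw v N.
    by exists (n - N)%N => //=; rewrite subnKC.
  move=> H v N; apply: contrapT => no; apply: H; exists v => // /(_ N I)[n _ Xn].
  by apply: no; exists (N + n)%N => //; exact: leq_addr.
apply: measurableC; apply: countable_bigcupT_measurable => [|v]; first exact: countableP.
apply: measurableC; apply: bigcapT_measurable => N; apply: bigcupT_measurable => n.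
exact: walk_measurable hX _ _.
Qed.

Let closed_root : father_closed [:: [::] : vertex b].
Proof. by move=> v; rewrite !inE => /eqP ->. Qed.

Let win_start L k : win p q L k ([::] : vertex b) [::] = 1 - survive b p q L k.
Proof. by rewrite /survive opprB addrC subrK /win subn0. Qed.

(** Outside a null set, a walk that is not recurrent visits no vertex infinitely
    often. Hence it loops at the root finitely many times and reaches every
    level, which is the loss of the game with target [k], for some [k], at all
    depths [L]; this has a probability of at most [survive L k]. *)
Lemma recurrent_of_extinction :
  (forall k e, 0 < e -> exists L, survive b p q L k < e) -> P recurrent_set = 1%E.
Proof.
move=> ext.
pose S k := [set w | (forall n, (root_loops (prior (X^~ w) n.+1) < k)%N) /\
                     forall L, exists n, reaches L (prior (X^~ w) n.+1)].
have negS k : P.-negligible (S k).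
  apply: negligible_eventually => e e0; have [L Le] := ext k e e0.
  pose A h := (k <= root_loops h)%N || ~~ reaches L.+1 h.
  exists (fun n => [set w | ~~ A (prior (X^~ w) n.+1)]); split=> [n|n|w [few deep]].
  - exact: (measurable_path hX (fun h => ~~ A h)).
  - rewrite (path_law b_gt0 hX n (fun h => ~~ A h)).
    rewrite (_ : (fun h => (~~ A h)%:R) = fun h => -1 * (A h)%:R + 1); last first.
      by apply/funext => h; case: (A h); rewrite ?mulr1 ?mulr0 ?addNr ?add0r.
    rewrite expect_lin //.
    have H : win p q L.+1 k ([::] : vertex b) [::]
          <= expect p q n (fun h => (A h)%:R) [::] [::].
      exact: win_le_expect.
    rewrite win_start in H; have := survive_decr b_gt1 p01 q0 q1 L k; lra.
  - have [n0 deep0] := deep L.+1; exists n0 => // n _ /=.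
    rewrite /A negb_or -ltnNge few negbK /=.
    elim: n => [|n IH]; first by rewrite addn0.
    by rewrite addnS /reaches /= orbC; move: IH; rewrite /reaches /= => ->.
have mR := measurable_recurrent_set.
apply: probability1 => //.
apply: (@negligibleS _ _ _ P (\bigcup_k S k `|`
    ~` [set w | forall y o, visited_io w y -> step_io y o w])); last first.
  by apply: negligibleU; [exact: negligible_bigcup|exact: ae_all_steps].
move=> w nR.
have [steps|] := pselect (forall y o, visited_io w y -> step_io y o w); last by right.
left; have none y : ~ visited_io w y.
  by move=> vy; apply: nR; apply: visited_io_all => //; exists y.
have /existsNP[N HN] := none [::].
have away n : (N <= n)%N -> X n w != [::] by move=> Nn; apply/eqP => e; apply: HN; exists n.
exists N.+1 => //; split=> [n|L].
  suff : (root_loops (prior (X^~ w) n.+1) <= minn n N)%N.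
    by rewrite leq_min ltnS => /andP[].
  elim: n => [|n IH]; first by [].
  have -> : root_loops (prior (X^~ w) n.+2) = ((X n.+1 w == [::]) && (X n w == [::])
      + root_loops (prior (X^~ w) n.+1))%N by [].
  move: (root_loops _) IH => r IH.
  have [Nn|nN] := leqP N n; first by rewrite (negPf (away _ Nn)) andbF; lia.
  by case: (_ && _); lia.
apply: contrapT => shallow; have [y] : exists y, visited_io w y.
  apply: (@visited_io_shallow w L) => n; rewrite leqNgt; apply/negP => deep.
  by apply: shallow; exists n; rewrite /reaches /= (ltnW deep).
exact: none.
Qed.

(** A recurrent walk would almost surely loop [k] times at the root, but by time
    [n] it has done so with at most the probability of winning the game of depth
    [n.+1]. *)
Lemma not_recurrent_of_survival k e : 0 < e ->
  (forall L, e <= survive b p q L k) -> P recurrent_set <> 1%E.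
Proof.
move=> e0 surv PR.
have mR := measurable_recurrent_set.
pose A h := (k <= root_loops h)%N.
pose B n := [set w | A (prior (X^~ w) n.+1)].
have mB n : measurable (B n) by exact: (measurable_path hX A).
have mE := measurable_eventually mB.
have Be n : Pr P (B n) <= 1 - e.
  rewrite /B (path_law b_gt0 hX n A).
  have : expect p q n (fun h => (A h)%:R) [::] [::] <= win p q n.+1 k ([::] : vertex b) [::].
    by apply: expect_le_win => //; rewrite ?addn0 ?orbT.
  rewrite win_start; have := surv n.+1; lra.
have := Pr_eventually mB Be.
suff -> : Pr P (eventually B) = 1 by lra.
rewrite /Pr probability1 //.
apply: (@negligibleS _ _ _ P (~` recurrent_set `|`
    ~` [set w | forall y o, visited_io w y -> step_io y o w])); last first.
  apply: negligibleU; last exact: ae_all_steps.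
  exists (~` recurrent_set); split=> //; first exact: measurableC.
    have E0 : P (~` recurrent_set) = 0%E by rewrite probability_setC // PR subee.
    exact: E0.
move=> w nE; have [Rw|] := pselect (recurrent_set w); last by left.
right=> steps; apply: nE.
have loops := steps [::] None (Rw [::]).
have mono m n : (m <= n)%N ->
    (root_loops (prior (X^~ w) m.+1) <= root_loops (prior (X^~ w) n.+1))%N.
  move=> /subnKC <-; elim: (n - m)%N => [|i IH]; first by rewrite addn0.
  by rewrite addnS; apply: leq_trans IH _; exact: leq_addl.
have [n0 H] : exists n0, (k <= root_loops (prior (X^~ w) n0.+1))%N.
  elim: k {surv A B mB mE Be} => [|k [n0 IH]]; first by exists 0%N.
  have [n [n0n Xn XSn]] := loops n0; exists n.+1.
  have -> : root_loops (prior (X^~ w) n.+2) = ((X n.+1 w == [::]) && (X n w == [::])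
      + root_loops (prior (X^~ w) n.+1))%N by [].
  by rewrite XSn Xn /= add1n ltnS; exact: leq_trans IH (mono _ _ n0n).
by exists n0 => // n _; apply: leq_trans H (mono _ _ _); exact: leq_addr.
Qed.

End Recurrence.

Theorem corollary1p6 (R : realType) (d : measure_display)
    (Omega : measurableType d) (P : probability Omega R)
    (b : nat) (hb : (2 <= b)%N)
    (p q : R) (hp : 0 <= p < 1) (hq : 0 < q < 1)
    (X : nat -> Omega -> vertex b)
    (hX : cookie_random_walk P [:: p] q X) :
  recurrent P X <-> lambda1 b p q <= 1 / b%:R.
Proof.
have /andP[q0 q1] := hq; have b0 : (0 < b)%N by exact: ltnW.
have bR0 : 0 < b%:R :> R by rewrite ltr0n.
rewrite div1r; split=> [rec|lam].
  rewrite leNgt; apply/negP => lam.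
  have [k [e [e0 surv]]] := survive_transient b0 hb hp q0 q1 lam.
  exact: (not_recurrent_of_survival hb hp q0 q1 hX e0 surv rec).
(* If the mean is at least [1], then [lambda1] is at least [(1 - p) + p = 1]. *)
have m1 : son_mean b q < 1.
  rewrite ltNge; apply/negP => m1.
  move: lam; rewrite /lambda1 -/(son_mean b q); apply/negP; rewrite -ltNge.
  have /andP[p0 p1] := hp.
  have b2 : 2 <= b%:R :> R by rewrite ler_nat.
  have bi : b%:R^-1 <= 1 / 2 :> R by rewrite div1r lef_pV2 ?posrE.
  have msq : 1 <= son_mean b q ^+ 2 by rewrite expr2 -[X in X <= _]mulr1 ler_pM.
  have h1 : 1 - p <= (1 - p) * son_mean b q ^+ 2 by rewrite ler_peMr // subr_ge0 ltW.
  have c0 : 0 <= (b%:R - 1) * p / b%:R.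
    by rewrite divr_ge0 ?(ltW bR0) // mulr_ge0 // subr_ge0; lra.
  have h2 : (b%:R - 1) * p / b%:R <= (b%:R - 1) * p / b%:R * son_mean b q.
    by rewrite ler_peMr.
  have h3 : (b%:R - 1) * p / b%:R + p / b%:R = p by field; rewrite gt_eqF.
  lra.
apply: (recurrent_of_extinction hb hp q0 q1 hX) => k e e0.
apply: survive_subcritical => //.
by rewrite -ler_pdivlMl // mulr1.
Qed.
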